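(* Let $\delta\in(0,1]$ and let $(p_n)_{n\ge 1}$ be a sequence in $[0,1]$. Consider the anisotropic long-range percolation model with parameters $\delta$ and $(p_n)_{n\geq 1}$ on the graph $G^{an}$ with vertex set $\mathbb{Z}^2$, and its truncations $P^K$, $K\in\{1,2,\dots\}$. If $$\limsup_{N\to\infty}\sum_{n=1}^{\infty} p_n p_{n+N}>0$$ (where the sums take values in $[0,\infty]$), then $$\lim_{K\to\infty}P^K\{(0,0)\leftrightarrow\infty\}=1.$$
   Context: The graph $G^{an}=(\mathbb{Z}^2,\mathbb{E}^{an})$ is the unoriented graph with vertex set $\mathbb{Z}^2$ and set of bonds $\mathbb{E}^{an}=\mathbb{E}^v\cup\left(\bigcup_{n\ge1}\mathbb{E}^h_n\right)$, where $\mathbb{E}^v=\{\langle x,x+(0,1)\rangle : x\in\mathbb{Z}^2\}$ is the set of nearest-neighbour vertical bonds and $\mathbb{E}^h_n=\{\langle x,x+(n,0)\rangle : x\in\mathbb{Z}^2\}$ is the set of horizontal bonds of length $n$. The anisotropic percolation model with parameters $\delta$ and $(p_n)_{n\ge1}$ is the product probability measure $P$ on $\{0,1\}^{\mathbb{E}^{an}}$ under which the bonds are independently open (value $1$) or closed (value $0$), each bond in $\mathbb{E}^v$ being open with probability $\delta$ and each bond in $\mathbb{E}^h_n$ being open with probability $p_n$. For a positive integer $K$, the truncated measure $P^K$ is the product measure defined in the same way with the same $\delta$ but with $(p_n)_n$ replaced by $(p_n^K)_n$, where $p_n^K=p_n$ if $n\le K$ and $p_n^K=0$ if $n>K$. The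 event $\{(0,0)\leftrightarrow\infty\}$ is the set of configurations in which there exists an infinite (self-avoiding) path of open bonds starting from $(0,0)$. *)

(* Defs.v *)
From HB Require Import structures.
From mathcomp Require Import all_boot all_order all_algebra.
From mathcomp Require Import all_classical all_reals all_analysis.

Set Implicit Arguments.
Unset Strict Implicit.
Unset Printing Implicit Defensive.
Import Order.TTheory GRing.Theory Num.Theory.
Import numFieldNormedType.Exports.

Local Open Scope classical_set_scope.
Local Open Scope ring_scope.

(* {0,1}^I with the product sigma-algebra. *)
Definition coordinate_events (I : Type) : set (set (I -> bool)) :=
  [set A | exists i, exists B, A = [set w | B (w i)]].

Notation bits I := (g_sigma_algebraType (@coordinate_events I)).

Definition rectangle (I : eqType) (s : seq I) (B : I -> set bool)
  : set (I -> bool) := [set w | forall i, i \in s -> B i (w i)].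

Definition is_product_measure (R : realType) (I : eqType)
    (mu : I -> probability bool R) (P : probability (bits I) R) : Prop :=
  forall (s : seq I) (B : I -> set bool), uniq s ->
    P (rectangle s B) = (\prod_(i <- s) mu i (B i))%E.

(* Existence of product measures on {0,1}^nat: the finitely additive product
   content on the algebra of cylinders is sigma-subadditive by compactness of
   the Cantor space, hence extends to the generated sigma-algebra. *)

Definition coins := nat -> bool.
HB.instance Definition _ := Pointed.on coins.

Definition determined (n : nat) (A : set coins) :=
  forall w w' : coins, (forall i, (i < n)%N -> w i = w' i) -> A w -> A w'.

Definition cylinders : set (set coins) := [set A | exists n, determined n A].

Lemma determinedS m n A : (m <= n)%N -> determined m A -> determined n A.
Proof.
by move=> mn h w w' e; apply: h => i im; apply: e; exact: leq_trans mn.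
Qed.

Lemma cylinders0 : cylinders set0. Proof. by exists 0%N. Qed.

Lemma cylindersU : setU_closed cylinders.
Proof.
move=> A B [m Am] [n Bn]; exists (maxn m n) => w w' e [Aw|Bw]; [left|right].
  by apply: (determinedS (leq_maxl m n) Am) Aw.
by apply: (determinedS (leq_maxr m n) Bn) Bw.
Qed.

Lemma cylindersC : setC_closed cylinders.
Proof.
move=> A [m Am]; exists m => w w' e nA Aw'; apply: nA.
by apply: Am Aw' => i im; rewrite e.
Qed.

Definition cylinder_display : measure_display. Proof. exact. Qed.

HB.instance Definition _ := @isAlgebraOfSets.Build cylinder_display coins
  cylinders cylinders0 cylindersU cylindersC.

Definition coins_cons (b : bool) (w : coins) : coins :=
  fun i => if i is j.+1 then w j else b.

Section product_content.
Variable R : realType.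
Implicit Types (m : nat -> bool -> R) (A B : set coins).

(* Measure of A when the coordinates of index >= n are all frozen to false. *)
Fixpoint weight m n A : R :=
  if n is n'.+1 then
    \sum_(b : bool) m 0%N b *
      weight (fun i => m i.+1) n' [set w | A (coins_cons b w)]
  else `[< A (fun=> false) >]%:R.

Definition is_weights m :=
  (forall i b, 0 <= m i b) /\ (forall i, m i true + m i false = 1).

Lemma is_weightsS m : is_weights m -> is_weights (fun i => m i.+1).
Proof. by case=> ? ?; split. Qed.

Lemma weight_ge0 m n A : is_weights m -> 0 <= weight m n A.
Proof.
elim: n m A => [|n IH] m A hm /=; first exact: ler0n.
apply: sumr_ge0 => b _; rewrite mulr_ge0//; first exact: hm.1.
by apply: IH; exact: is_weightsS.
Qed.

Lemma weightT m n : is_weights m -> weight m n setT = 1.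
Proof.
elim: n m => [|n IH] m hm /=; first by rewrite asboolT.
rewrite big_bool /= (_ : [set w | _] = setT)// IH ?mulr1; last exact: is_weightsS.
exact: hm.2.
Qed.

Lemma weightU m n A B : A `&` B = set0 ->
  weight m n (A `|` B) = weight m n A + weight m n B.
Proof.
elim: n m A B => [|n IH] m A B AB /=.
  have : ~ (A `&` B) (fun=> false) by rewrite AB.
  do 3!case: asboolP => //= ; rewrite ?addr0 ?add0r //;
    rewrite /setU /setI /=; tauto.
rewrite -big_split/=; apply: eq_bigr => b _; rewrite -mulrDr -IH//.
apply/seteqP; split => // w /= ABw.
by have : (A `&` B) (coins_cons b w) by []; rewrite AB.
Qed.

Lemma weight0 m n : weight m n set0 = 0.
Proof.
by have /eqP := @weightU m n set0 set0 (setI0 _); rewrite setU0 -subr_eq0 opprD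
  addrA subrr sub0r oppr_eq0 => /eqP.
Qed.

Lemma weight_le m n A B : is_weights m -> A `<=` B -> weight m n A <= weight m n B.
Proof.
move=> hm AB; rewrite -(setDUK AB) weightU ?lerDl ?weight_ge0//.
by apply/seteqP; split => // w [? []].
Qed.

Lemma weight_leU m n A B : is_weights m ->
  weight m n (A `|` B) <= weight m n A + weight m n B.
Proof.
move=> hm; have -> : A `|` B = A `|` (B `\` A).
  apply/seteqP; split=> w; last by move=> [|[]]; [left|right].
  by case: (pselect (A w)) => Aw; [left|move=> [//|]; right].
rewrite weightU; last first.
  by apply/seteqP; split => // w [? []].
by rewrite lerD2l weight_le.
Qed.

Lemma weight_stable m n A k : is_weights m -> determined n A ->
  weight m (n + k) A = weight m n A.
Proof.
elim: n m A k => [|n IH] m A k hm hA; rewrite ?add0n ?addSn /=.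
  case: asboolP => A0.
    suff -> : A = setT by rewrite weightT.
    by apply/seteqP; split => // w _; apply: hA A0.
  suff -> : A = set0 by rewrite weight0.
  by apply/seteqP; split => // w Aw; apply: A0; apply: hA Aw.
apply: eq_bigr => b _; rewrite IH//; first exact: is_weightsS.
by move=> w w' e /=; apply: hA => -[|i] //= /e.
Qed.

End product_content.

Section product_premeasure.
Variables (R : realType) (mu : nat -> probability bool R).

Definition law_weights (i : nat) (b : bool) : R := fine (mu i [set b]).

Lemma law_weightsP : is_weights law_weights.
Proof.
have fin i (A : set bool) : mu i A \is a fin_num by exact: fin_num_measure.
split=> i; first by move=> b; exact: fine_ge0.
rewrite /law_weights -fineD// -measureU//; last first.
  by apply/seteqP; split => // b [/= ->].
by rewrite -setT_bool [X in fine X](probability_setT (mu i)).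
Qed.

Definition level (A : set coins) : nat := xget 0%N [set n | determined n A].

Definition product_content (A : set coins) : \bar R :=
  (weight law_weights (level A) A)%:E.

Lemma product_contentE n A : determined n A ->
  product_content A = (weight law_weights n A)%:E.
Proof.
move=> hA; have hl : determined (level A) A.
  by rewrite /level; case: xgetP => [k _ //|/(_ n)].
rewrite /product_content; congr _%:E.
have e k : determined k A -> weight law_weights (maxn k (maxn n (level A))) A =
    weight law_weights k A.
  move=> kA; rewrite -{1}(subnKC (leq_maxl k (maxn n (level A)))).
  exact: weight_stable law_weightsP kA.
rewrite -(e n hA) -(e _ hl); congr weight.
by rewrite maxnCA maxnn maxnA maxnn.
Qed.

Lemma cylinders_level (F : nat -> set coins) n :
  (forall k, cylinders (F k)) -> exists N, forall k, (k < n)%N -> determined N (F k).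
Proof.
move=> /choice[N hN]; exists (\max_(k < n) N k) => k kn.
apply: determinedS (hN k).
exact: (leq_bigmax_cond (F := fun k : 'I_n => N k) (Ordinal kn)).
Qed.

Lemma determined_bigU (F : nat -> set coins) n N :
  (forall k, (k < n)%N -> determined N (F k)) ->
  determined N (\big[setU/set0]_(k < n) F k).
Proof.
move=> h w w' e; rewrite -!bigcup_mkord => -[k /= kn Fw]; exists k => //.
exact: h e Fw.
Qed.

Let content_ge0 A : (0 <= product_content A)%E.
Proof. by rewrite lee_fin weight_ge0//; exact: law_weightsP. Qed.

Let content_semi_additive : measure_function.semi_additive product_content.
Proof.
move=> F n mF tF _.
have [N hN] := cylinders_level n mF.
rewrite (product_contentE (determined_bigU hN)).
have -> : weight law_weights N (\big[setU/set0]_(k < n) F k) =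
    \sum_(k < n) weight law_weights N (F k).
  elim: n {hN} => [|n IH]; first by rewrite !big_ord0 weight0.
  rewrite !big_ord_recr /= weightU ?IH//;
    last by apply: (@trivIset_bigsetUI _ predT) => //;
      rewrite [X in trivIset X](_ : _ = setT)//; apply/seteqP.
rewrite -sumEFin; apply: eq_bigr => k _.
by rewrite (product_contentE (hN k (ltn_ord k))).
Qed.

HB.instance Definition _ := isContent.Build cylinder_display coins R
  product_content content_ge0 content_semi_additive.

Lemma determined_open n (A : set coins) :
  determined n A -> open (A : set cantor_space).
Proof.
move=> hA; have opC w : open ([set w' | forall i, (i < n)%N -> w i = w' i]
    : set cantor_space).
  elim: n {hA} => [|n IH].
    by rewrite (_ : [set _ | _] = setT)//; [exact: openT|apply/seteqP; split].
  rewrite (_ : [set _ | _] =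
    [set w' | forall i, (i < n)%N -> w i = w' i] `&`
    (proj n : cantor_space -> bool) @^-1` [set w n]).
    apply: openI => //; apply: open_comp; last exact: discrete_open.
    by move=> x _; exact: proj_continuous.
  apply/seteqP; split=> w' /=.
    by move=> h; split; [move=> i /ltnW/h|rewrite /proj h].
  by move=> [h e] i; rewrite ltnS leq_eqVlt => /orP[/eqP ->|/h//]; rewrite -e.
rewrite (_ : A = \bigcup_(w in A) [set w' | forall i, (i < n)%N -> w i = w' i]).
  exact: bigcup_open.
apply/seteqP; split=> [w Aw|w [w' Aw' /hA]]; first by exists w.
exact.
Qed.

Let content_sigma_subadditive :
  measurable_subset_sigma_subadditive product_content.
Proof.
move=> A F mF [nA hA] AF.
have opF i : open (F i : set cantor_space).
  by have [n] := mF i; exact: determined_open.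
have clA : closed (A : set cantor_space).
  rewrite -[A]setCK; apply: open_closedC.
  apply: (@determined_open nA) => w w' e nw Aw; apply: nw.
  by apply: hA Aw => i /e.
have := subclosed_compact clA cantor_space_compact (@subsetT _ _).
rewrite compact_cover => /(_ nat setT F (fun i _ => opF i) AF)[D _ AD].
pose n := (\max_(i <- finmap.enum_fset D) i).+1.
have {}AD : A `<=` \big[setU/set0]_(k < n) F k.
  move=> w /AD[i /= iD Fw]; rewrite -bigcup_mkord; exists i => //=.
  by rewrite ltnS; exact: (leq_bigmax_seq (F := id)).
have [N hN] := cylinders_level n mF.
have le : (product_content A <= \sum_(k < n) product_content (F k))%E.
  rewrite (@product_contentE (maxn nA N))//; last first.
    exact: determinedS (leq_maxl _ _) hA.
  under eq_bigr => k _.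
    rewrite (@product_contentE (maxn nA N)); last first.
      exact: determinedS (leq_maxr _ _) (hN k (ltn_ord k)).
    over.
  rewrite sumEFin lee_fin.
  apply: le_trans (weight_le _ law_weightsP AD) _.
  elim: n {hN AD} => [|n IH]; first by rewrite !big_ord0 weight0.
  rewrite !big_ord_recr /=.
  apply: le_trans (weight_leU _ _ _ law_weightsP) _.
  by rewrite lerD2r.
apply: le_trans le _; rewrite -(big_mkord predT (fun k => product_content (F k))).
exact: nneseries_lim_ge.
Qed.

HB.instance Definition _ := Content_SigmaSubAdditive_isMeasure.Build
  cylinder_display R coins product_content content_sigma_subadditive.

Definition coins_measure := measure_extension product_content.
HB.instance Definition _ := Measure.on coins_measure.

Lemma coins_measureE n A : determined n A ->
  coins_measure A = (weight law_weights n A)%:E.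
Proof.
move=> hA; rewrite /coins_measure /measure_extension measurable_mu_extE.
  exact: product_contentE.
by exists n.
Qed.

Let coins_measureT : coins_measure setT = 1%E.
Proof. by rewrite (@coins_measureE 0)// weightT//; exact: law_weightsP. Qed.

HB.instance Definition _ := Measure_isProbability.Build _ _ R coins_measure
  coins_measureT.

Lemma coins_measure_rectangle n (B : nat -> set bool) :
  coins_measure [set w | forall i, (i < n)%N -> B i (w i)] =
  (\prod_(i < n) mu i (B i))%E.
Proof.
rewrite (@coins_measureE n); last by move=> w w' e h i /[dup] ? /h; rewrite e.
rewrite (eq_bigr (fun i : 'I_n => (fine (mu i (B i)))%:E)); last first.
  by move=> i _; rewrite fineK// fin_num_measure.
rewrite prodEFin; congr _%:E.
have fineB i : fine (mu i (B i)) = \sum_(b | `[< B i b >]) law_weights i b.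
  have e b : (if `[< B i b >] then law_weights i b else 0) =
      fine (mu i (B i `&` [set b])).
    case: asboolP => Bb; first by rewrite setIC setIidl// => _ ->.
    rewrite (_ : _ `&` _ = set0) ?measure0//.
    by apply/seteqP; split => // c [Bc ec]; apply: Bb; rewrite -ec.
  rewrite big_mkcond big_bool /= !e -fineD ?fin_num_measure// -measureU//.
    by rewrite -setIUr -setT_bool setIT.
  by apply/seteqP; split => // c [[_ /= ->] []].
have gen : forall (m : nat -> bool -> R) (C : nat -> set bool), is_weights m ->
    weight m n [set w | forall i, (i < n)%N -> C i (w i)] =
    \prod_(i < n) \sum_(b | `[< C i b >]) m i b.
  elim: n => [|n IH] m C hm /=.
    by rewrite big_ord0; case: asboolP => // -[].
  rewrite big_ord_recl.
  have /esym := IH (fun i => m i.+1) (fun i => C i.+1) (is_weightsS hm).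
  rewrite /= => ->; rewrite big_distrl [RHS]big_mkcond /=.
  apply: eq_bigr => b _; case: asboolP => [Cb|Cb].
    congr (_ * weight _ _ _); apply/seteqP; split => w /= h.
      by move=> i ni; apply: (h i.+1).
    by move=> [|i] //= ni; exact: h.
  rewrite (_ : [set _ | _] = set0) ?weight0 ?mulr0//.
  by apply/seteqP; split => // w /= /(_ 0%N isT).
rewrite gen; last exact: law_weightsP.
by apply: eq_bigr => i _; rewrite fineB.
Qed.

End product_premeasure.

Section product_measure.
Variables (R : realType) (I : countType) (mu : I -> probability bool R).

Let coins_law (n : nat) : probability bool R :=
  if pickle_inv n is Some i then mu i else bernoulli_prob 0.

Let reindex (w : g_sigma_algebraType (@measurable _ coins)) : bits I :=
  fun i => w (pickle i).

Let measurable_reindex : measurable_fun setT reindex.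
Proof.
have := @measurability _ _ _ (bits I) setT reindex (@coordinate_events I) erefl.
apply.
move=> _ [_ [i [B ->]] <-]; rewrite setTI; apply: sub_sigma_algebra.
by exists (pickle i).+1 => w w' e /=; rewrite /reindex e.
Qed.

HB.instance Definition _ :=
  isMeasurableFun.Build _ _ _ _ reindex measurable_reindex.

Lemma product_measure_exists :
  exists P : probability (bits I) R, is_product_measure mu P.
Proof.
exists (distribution (coins_measure coins_law) reindex) => s B us.
rewrite /distribution /pushforward /=.
pose C n : set bool :=
  if pickle_inv n is Some i then (if i \in s then B i else setT) else setT.
pose N := (\max_(i <- s) pickle i).+1.
have sN i : i \in s -> (pickle i < N)%N.
  by move=> si; rewrite ltnS; exact: (leq_bigmax_seq (F := pickle)).
rewrite (_ : _ @^-1` _ = [set w | forall n, (n < N)%N -> C n (w n)]); last first.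
  apply/seteqP; split => w /= h.
    move=> n _; rewrite /C; case E: (pickle_inv n) => [i|//].
    have := @pickle_invK I n; rewrite E /= => <-.
    by case: ifP => // /h.
  move=> i si; have := h _ (sN _ si); by rewrite /C pickleK_inv si.
rewrite coins_measure_rectangle -(big_mkord predT (fun n => coins_law n (C n))).
transitivity (\prod_(0 <= n < N | n \in map pickle s) coins_law n (C n))%E.
  rewrite [RHS]big_mkcond; apply: eq_bigr => n _; case: ifPn => // ns.
  rewrite (_ : C n = setT) ?probability_setT// /C.
  case E: (pickle_inv n) => [i|//]; case: ifP => // si.
  have := @pickle_invK I n; rewrite E /= => ni.
  by move: ns; rewrite -ni map_f.
rewrite -[LHS]big_filter (perm_big (map pickle s)); last first.
  apply: uniq_perm; rewrite ?filter_uniq ?iota_uniq//.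
    by rewrite map_inj_uniq//; exact: (pcan_inj pickleK).
  move=> n. rewrite mem_filter mem_index_iota /=.
  by case: mapP => // -[i si ->]; rewrite sN.
rewrite big_map; apply: eq_big_seq => i si.
by rewrite /coins_law /C pickleK_inv si.
Qed.

Definition product_measure : probability (bits I) R :=
  projT1 (cid product_measure_exists).

Lemma product_measureP : is_product_measure mu product_measure.
Proof. exact: (projT2 (cid product_measure_exists)). Qed.

End product_measure.

(* Vertical bonds are [inl x], joining x and x + (0,1); horizontal bonds of
   length n are [inr (x, n)], joining x and x + (n,0). *)
Definition vertex := (int * int)%type.
Definition bond := (vertex + vertex * {n : nat | (0 < n)%N})%type.

Definition endpoints (e : bond) : vertex * vertex :=
  match e with
  | inl x => (x, (x.1, x.2 + 1))
  | inr (x, n) => (x, (x.1 + (val n)%:Z, x.2))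
  end.

Definition open_step (w : bond -> bool) (x y : vertex) : Prop :=
  exists e : bond, w e /\ (endpoints e = (x, y) \/ endpoints e = (y, x)).

Definition origin_to_infinity : set (bond -> bool) :=
  [set w | exists gamma : nat -> vertex, [/\ gamma 0%N = (0, 0),
     injective gamma & forall i, open_step w (gamma i) (gamma i.+1)]].

Definition bond_law (R : realType) (delta : R) (p : nat -> R) (e : bond)
    : probability bool R :=
  match e with
  | inl _ => bernoulli_prob delta
  | inr (_, n) => bernoulli_prob (p (val n))
  end.

(* The graph is not locally finite, so the existence of an infinite open path
   need not belong to the product sigma-algebra. It is measurable for the
   completion of each truncated measure: see [measurable_origin_to_infinity]. *)
Definition percolation_measure (R : realType) (delta : R) (p : nat -> R)
    : set (bond -> bool) -> \bar R :=
  @completed_measure_extension _ _ _ (product_measure (bond_law delta p)).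

Definition truncate (R : realType) (p : nat -> R) (K n : nat) : R :=
  if (n <= K)%N then p n else 0.

Lemma percolation_measureE (R : realType) (delta : R) (p : nat -> R)
    (A : set (bits bond)) : measurable A ->
  percolation_measure delta p A = product_measure (bond_law delta p) A.
Proof. exact: measurable_mu_extE. Qed.

Section measurability.
Variables (R : realType) (delta : R) (p : nat -> R) (K : nat).

Let mu := product_measure (bond_law delta (truncate p K)).
Local Notation completed := (caratheodory_type (mu_ext mu)).

Let measurable_ex d (T : measurableType d) (J : countType) (F : J -> set T) :
  (forall j, measurable (F j)) -> measurable [set w | exists j, F j w].
Proof.
move=> mF; rewrite (_ : [set _ | _] =
    \bigcup_n (if unpickle n is Some j then F j else set0)).
  by apply: bigcupT_measurable => n; case: unpickle.
apply/seteqP; split => w /=.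
  by move=> [j Fj]; exists (pickle j) => //; rewrite pickleK.
by move=> [n _]; case: unpickle => // j Fj; exists j.
Qed.

Let measurable_and d (T : measurableType d) (Q : Prop) (A : set T) :
  (Q -> measurable A) -> measurable [set w | Q /\ A w].
Proof.
move=> mA; have [q|nq] := pselect Q.
  rewrite (_ : [set _ | _] = A); first exact: mA.
  by apply/seteqP; split => w //= [].
by rewrite (_ : [set _ | _] = set0)//; apply/seteqP; split => w // [].
Qed.

Let measurable_open e : measurable [set w : bits bond | w e].
Proof. by apply: sub_sigma_algebra; exists e, [set b : bool | b]. Qed.

Let long : set (bond -> bool) := [set w |
  exists x : vertex * {n : nat | (0 < n)%N}, (K < val x.2)%N /\ w (inr x)].

Let measurable_long : measurable (long : set (bits bond)).
Proof.
apply: measurable_ex => x; apply: measurable_and => _.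
exact: measurable_open.
Qed.

Let negligible_ex (J : countType) (F : J -> set (bits bond)) :
  (forall j, mu.-negligible (F j)) -> mu.-negligible [set w | exists j, F j w].
Proof.
move=> F0; rewrite (_ : [set _ | _] =
    \bigcup_n (if unpickle n is Some j then F j else set0)).
  by apply: negligible_bigcup => n; case: unpickle => // ; exact: negligible_set0.
apply/seteqP; split => w /=.
  by move=> [j Fj]; exists (pickle j) => //; rewrite pickleK.
by move=> [n _]; case: unpickle => // j Fj; exists j.
Qed.

Let mu_long : mu long = 0%E.
Proof.
apply: measure_negligible; first exact: measurable_long.
apply: negligible_ex => -[x n].
have [Kn|nK] := ltnP K (val n); last first.
  by apply: negligibleS (negligible_set0 mu) => w [].
apply: (@negligibleS _ _ _ _ [set w : bits bond | w (inr (x, n))]); first by move=> w [].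
apply/negligibleP; first exact: measurable_open.
transitivity (mu (rectangle [:: inr (x, n) : bond] (fun=> [set true]))).
  congr (mu _); apply/seteqP; split => w /=.
    by move=> wx e; rewrite inE => /eqP ->.
  by apply; rewrite mem_head.
rewrite product_measureP// big_seq1 /=.
rewrite /truncate leqNgt Kn /= /bernoulli_prob lexx ler01 /=.
by rewrite fsbig_set1.
Qed.

Let step (w : bond -> bool) (x y : vertex) : bool := `[< open_step w x y >].

Let origin : vertex := (0, 0).

Let extensible (w : bond -> bool) (s : seq vertex) (n : nat) := exists t,
  size t = n /\ (uniq (origin :: s ++ t) && path (step w) origin (s ++ t)).

Let extensible_le w s m n : (m <= n)%N -> extensible w s n -> extensible w s m.
Proof.
move=> mn [t [st h]]; exists (take m t); split.
  by rewrite size_takel ?st.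
move: h; rewrite -{1 2}(cat_take_drop m t) !catA -cat_cons cat_uniq cat_path.
by move=> /andP[/andP[-> _] /andP[-> _]].
Qed.

Let neighbours (x : vertex) : seq vertex :=
  [:: (x.1, x.2 + 1); (x.1, x.2 - 1)] ++
  [seq (x.1 + i%:Z, x.2) | i <- iota 0 K.+1] ++
  [seq (x.1 - i%:Z, x.2) | i <- iota 0 K.+1].

Let step_neighbours w x y : ~ long w -> step w x y -> y \in neighbours x.
Proof.
move=> nl /asboolP[[z|[z n]] [we exy]]; rewrite /neighbours !mem_cat.
  apply/orP; left; case: exy => -[<- <-]; rewrite !inE.
    by rewrite eqxx.
  by rewrite /= addrK -surjective_pairing eqxx orbT.
have nK : val n \in iota 0 K.+1.
  rewrite mem_iota leq0n add0n ltnS leqNgt; apply/negP => Kn; apply: nl.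
  by exists (z, n).
case: exy => -[<- <-].
  by apply/orP; right; apply/orP; left; apply/mapP; exists (val n).
apply/orP; right; apply/orP; right; apply/mapP; exists (val n) => //=.
by rewrite addrK -surjective_pairing.
Qed.

Let koenig w s : ~ long w -> (forall n, extensible w s n) ->
  exists y, forall n, extensible w (rcons s y) n.
Proof.
move=> nl hs; apply: contrapT => /forallNP hN.
have /choice[N hN'] y : exists n, ~ extensible w (rcons s y) n.
  by apply/existsNP; exact: hN.
have [[|y t] [//= [st] hy]] :=
  hs (\max_(y <- neighbours (last origin s)) N y).+1.
apply: (hN' y).
have ys : extensible w (rcons s y) (size t) by exists t; rewrite cat_rcons.
apply: extensible_le ys; rewrite st.
apply: (leq_bigmax_seq (F := N)) => //.
move: hy => /andP[_]; rewrite cat_path /= => /and3P[_ + _].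
exact: step_neighbours.
Qed.

Let origin_to_infinityE w : ~ long w ->
  origin_to_infinity w <-> forall n, extensible w [::] n.
Proof.
move=> nl; split => [[g [g0 gi gs]] n|h].
  exists [seq g i | i <- iota 1 n]; rewrite size_map size_iota; split => //.
  have -> : origin = g 0%N by rewrite g0.
  rewrite cat0s -map_cons map_inj_uniq// (iota_uniq 0 n.+1) /=.
  elim: n 0%N => //= n IH k; rewrite IH andbT.
  exact/asboolP/gs.
have /choice[f hf] s : exists y, (forall n, extensible w s n) ->
    forall n, extensible w (rcons s y) n.
  have [hs|nhs] := pselect (forall n, extensible w s n); last by exists origin.
  by have [y hy] := koenig nl hs; exists y.
pose S k := iter k (fun s => rcons s (f s)) [::].
have hS k n : extensible w (S k) n by elim: k n => [//|k IH]; exact: hf.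
pose g k := last origin (S k).
have SE k : S k = [seq g i | i <- iota 1 k].
  elim: k => // k IH; rewrite -addn1 iotaD map_cat -IH add1n /=.
  by rewrite addn1 /g /= last_rcons cats1.
have good k : uniq (origin :: S k) && path (step w) origin (S k).
  by have [t [/size0nil ->]] := hS k 0%N; rewrite cats0.
exists g; split => //.
  have gu k : uniq [seq g i | i <- iota 0 k.+1].
    by have /andP[] := good k; rewrite SE.
  move=> i j gij; have := gu (maxn i j).
  move=> /(@uniqP _ origin _) /(_ i j).
  rewrite !inE size_map size_iota !ltnS leq_maxl leq_maxr => /(_ isT isT).
  by rewrite !(nth_map 0%N) ?size_iota ?ltnS ?leq_maxl ?leq_maxr//
     !nth_iota ?ltnS ?leq_maxl ?leq_maxr// !add0n => /(_ gij).
move=> i; have /andP[_] := good i.+1.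
rewrite /= rcons_path => /andP[_ /asboolP].
by rewrite /g /= last_rcons.
Qed.

Lemma measurable_origin_to_infinity :
  measurable (origin_to_infinity : set completed).
Proof.
have cara (A : set (bits bond)) : measurable A -> measurable (A : set completed).
  exact: caratheodory_measurable_mu_ext.
have m_step x y : measurable [set w : bits bond | step w x y].
  rewrite (_ : [set _ | _] = [set w : bits bond | exists e,
      (endpoints e = (x, y) \/ endpoints e = (y, x)) /\ w e]); last first.
    by apply/seteqP; split => w /= => [/asboolP|] [e [we h]];
      [|apply/asboolP]; exists e.
  apply: measurable_ex => e; apply: measurable_and => _.
  exact: measurable_open.
have m_path s : forall x, measurable [set w : bits bond | path (step w) x s].
  elim: s => [|y s IH] x /=.
    by rewrite (_ : [set _ | _] = setT)//; apply/seteqP; split.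
  rewrite (_ : [set _ | _] =
    [set w : bits bond | step w x y] `&` [set w | path (step w) y s]).
    exact: measurableI.
  by apply/seteqP; split => w /= /andP.
have m_ext : measurable [set w : bits bond | forall n, extensible w [::] n].
  rewrite (_ : [set _ | _] = \bigcap_n [set w : bits bond | extensible w [::] n]).
    apply: bigcapT_measurable => n; apply: measurable_ex => t.
    apply: measurable_and => _ /=.
    rewrite (_ : (fun _ => _) = [set w : bits bond | uniq (origin :: t) /\
        path (step w) origin t]).
      by apply: measurable_and => _; exact: m_path.
    by apply/funext => w; rewrite propeqE; split => [/andP|/andP].
  by apply/seteqP; split => w /= h n; [move=> _|]; exact: h.
rewrite (_ : origin_to_infinity =
    ([set w | forall n, extensible w [::] n] `\` long) `|`
    (origin_to_infinity `&` long)).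
  apply: measurableU; first by apply: cara; exact: measurableD.
  apply: measure_is_complete_caratheodory; exists long; split.
  - exact: cara.
  - by rewrite /= measurable_mu_extE.
  - exact: subIsetr.
apply/seteqP; split => w.
  move=> ow; have [lw|nl] := pselect (long w); first by right.
  by left; split => //; apply/origin_to_infinityE.
by move=> [[h nl]|[]//]; apply/origin_to_infinityE.
Qed.

End measurability.

(* Main.v *)
Require Import Defs.
From mathcomp Require Import all_boot all_order all_algebra.
From mathcomp Require Import all_classical all_reals all_analysis.
From mathcomp Require Import zify ring lra.
Import Order.TTheory GRing.Theory Num.Theory.
Import numFieldNormedType.Exports.
Local Open Scope classical_set_scope.
Local Open Scope ring_scope.

Set Implicit Arguments.
Unset Strict Implicit.
Unset Printing Implicit Defensive.

(** Write [S N] for the sum of the [p n * p (n + N)]. By hypothesis there are a constant [c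
    > 0] and arbitrarily large [N] with [S N > c].

    A vertex [x] is joined to [x + (N, 0)] by a bond of length [N + n] followed backwards by
    a bond of length [n]. The pairs of bonds obtained for distinct [n] are disjoint, so one
    of them is open with probability at least [c / (1 + c)] ([pr_leg]), already with
    finitely many [n]. Take a sparse sequence of such shifts [N 0 < N 1 < ...]
    ([sparse_sequence]) and let [D] be a much later shift. To go from [x] to [x + (0, 2)],
    jump by [N i], go up twice, and jump back; to go from [x] to [x + (D, 0)], jump by [N
    i], go up, jump by [D], go down, and jump back. Each of these detours is open with a
    probability bounded below ([pr_detour]), and the detours of distinct indices [i] are
    disjoint. With enough indices, every edge of the lattice spanned by [(D, 0)] and [(0,
    2)] is thus realised with probability close to 1, by bonds of bounded length. Because
    the residues modulo [D] of the shifts are distinct, and because the edges are given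
    indices in four classes, distinct edges use disjoint sets of bonds and so are
    independent ([detour_support_disjoint]).

    It remains to see that independent percolation on a quadrant of the square lattice, with
    good sites of density close to 1, joins the origin to infinity with probability close to
    1. No planar duality is used: boxes of side [3 ^ k] are declared bad when at least two
    of their nine sub-boxes are bad. The probability of a bad box is squared at each level,
    up to a constant ([pr_bad_event]), so all the boxes at the corner are good with
    probability close to 1 ([pr_no_bad_box]). Good adjacent boxes have connected cores
    ([core_connected]), hence the origin is then joined to infinitely many sites
    ([good_boxes_connect]). As only bonds of bounded length are involved, Koenig's lemma
    ([infinite_path]) yields an infinite path. *)

(** * Independence of local events *)

Definition supported (I : eqType) (F : seq I) (A : set (I -> bool)) : Prop :=
  forall w w' : I -> bool, {in F, w =1 w'} -> A w -> A w'.

(** The finite support only has to lie somewhere in [Q]: independence of two events then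
    reduces to the disjointness of two sets described by a formula, and no list of
    coordinates is ever computed. *)
Definition local (I : eqType) (Q : set I) (A : set (I -> bool)) : Prop :=
  exists2 F : seq I, (forall x, x \in F -> Q x) & supported F A.

Definition update (I : eqType) (x : I) (b : bool) (w : I -> bool) : I -> bool :=
  fun y => if y == x then b else w y.

Section local_events.
Variable I : eqType.
Implicit Types (F : seq I) (Q : set I) (A B : set (I -> bool)).

Lemma supported_nil A : supported [::] A -> A = setT \/ A = set0.
Proof.
move=> hA; have [[w Aw]|nA] := pselect (exists w, A w); [left|right].
  by apply/seteqP; split => // w' _; exact: hA Aw.
by apply/seteqP; split => // w Aw; apply: nA; exists w.
Qed.

(** Fixing the coordinate [x] removes it from the support; every induction on supports
    below runs on this. *)
Lemma supported_update x F A b :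
  supported (x :: F) A -> supported F [set w | A (update x b w)].
Proof.
move=> hA w w' e /=; apply: hA => y; rewrite inE /update.
by case: eqP => //= _; exact: e.
Qed.

Lemma rectangle1 (x : I) b : rectangle [:: x] (fun=> [set b]) = [set w | w x = b].
Proof.
apply/seteqP; split => w /=; first by apply; rewrite mem_head.
by move=> wx y; rewrite inE => /eqP ->.
Qed.

Lemma measurable_coordinate (x : I) (B : set bool) :
  measurable ([set w | B (w x)] : set (bits I)).
Proof. by apply: sub_sigma_algebra; exists x, B. Qed.

Lemma setI_update A (x : I) b :
  A `&` [set w | w x = b] = [set w | A (update x b w)] `&` [set w | w x = b].
Proof.
apply/seteqP; split => w /= [] + wx; rewrite (_ : update x b w = w)//;
  by apply/funext => y; rewrite /update; case: eqP => // ->.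
Qed.

Lemma set_split (x : I) A :
  A = (A `&` [set w | w x = true]) `|` (A `&` [set w | w x = false]).
Proof.
by rewrite -setIUr -[LHS]setIT; congr (_ `&` _); apply/seteqP; split => // w _ /=;
  case: (w x); [left|right].
Qed.

Lemma supported_measurable F A : supported F A -> measurable (A : set (bits I)).
Proof.
elim: F A => [|x F IH] A hA.
  by have [->|->] := supported_nil hA; [exact: measurableT|exact: measurable0].
rewrite (set_split x A) (setI_update A x true) (setI_update A x false).
apply: measurableU; apply: measurableI.
- by apply: IH; exact: supported_update.
- exact: (measurable_coordinate x [set true]).
- by apply: IH; exact: supported_update.
- exact: (measurable_coordinate x [set false]).
Qed.

Lemma local_measurable Q A : local Q A -> measurable (A : set (bits I)).
Proof. by case=> F _; exact: supported_measurable. Qed.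

Lemma localS Q Q' A : Q `<=` Q' -> local Q A -> local Q' A.
Proof. by move=> QQ [F FQ hA]; exists F => // x /FQ; exact: QQ. Qed.

Lemma local_coordinate (x : I) : local [set x] [set w | w x].
Proof.
exists [:: x] => [y|w w' e /=]; first by rewrite inE => /eqP.
by rewrite e // mem_head.
Qed.

Lemma localT Q : local Q setT. Proof. by exists [::]. Qed.

Lemma localC Q A : local Q A -> local Q (~` A).
Proof.
move=> [F FQ hA]; exists F => // w w' e nA Aw'; apply: nA; apply: hA Aw'.
by move=> x /e.
Qed.

Lemma localI Q Q' A B : local Q A -> local Q' B -> local (Q `|` Q') (A `&` B).
Proof.
move=> [F FQ hA] [G GQ hB]; exists (F ++ G).
  by move=> x; rewrite mem_cat => /orP[/FQ|/GQ]; [left|right].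
move=> w w' e [Aw Bw]; split; [apply: hA Aw|apply: hB Bw];
  by move=> x xF; apply: e; rewrite mem_cat xF ?orbT.
Qed.

Lemma localU Q A B : local Q A -> local Q B -> local Q (A `|` B).
Proof.
move=> hA hB; rewrite -[A `|` B]setCK setCU; apply: localC.
by rewrite -[Q]setUid; apply: localI; exact: localC.
Qed.

Lemma local_all (J : eqType) (s : seq J) Q (A : J -> set (I -> bool)) :
  (forall j, j \in s -> local Q (A j)) ->
  local Q [set w | forall j, j \in s -> A j w].
Proof.
elim: s => [|j s IH] h.
  by rewrite (_ : [set _ | _] = setT); [exact: localT|apply/seteqP; split].
rewrite (_ : [set _ | _] = A j `&` [set w | forall j, j \in s -> A j w]).
  rewrite -[Q]setUid; apply: localI; first by apply: h; rewrite mem_head.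
  by apply: IH => k ks; apply: h; rewrite inE ks orbT.
apply/seteqP; split => w /=.
  by move=> hw; split => [|k ks]; apply: hw; rewrite inE ?eqxx ?ks ?orbT.
by move=> [Aj As] k; rewrite inE => /orP[/eqP ->|/As].
Qed.

End local_events.

Section independence.
Variables (R : realType) (I : eqType) (mu : I -> probability bool R).
Variable P : probability (bits I) R.
Hypothesis PP : is_product_measure mu P.
Implicit Types (F s : seq I) (Q : set I) (A B : set (I -> bool)).

Let rect_indep A F := forall s C, uniq s -> (forall x, x \in s -> x \notin F) ->
  P (A `&` rectangle s C) = (P A * P (rectangle s C))%E.

Let measurable_rect s (C : I -> set bool) : measurable (rectangle s C : set (bits I)).
Proof.
apply: (@supported_measurable _ s) => w w' e /= h x xs.
by rewrite -e//; exact: h.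
Qed.

Let rect_cat s s' (C C' : I -> set bool) : (forall x, x \in s -> x \notin s') ->
  rectangle s C `&` rectangle s' C' =
  rectangle (s ++ s') (fun x => if x \in s then C x else C' x).
Proof.
move=> ss'; apply/seteqP; split => w /=.
  move=> [h h'] x; rewrite mem_cat; case: ifP => [xs _|_]; [exact: h|exact: h'].
move=> h; split => x xs; have := h x; rewrite mem_cat xs ?orbT => /(_ isT) //.
by case: ifP => // /ss'; rewrite xs.
Qed.

Let rect_indep_rect s C : uniq s -> rect_indep (rectangle s C) s.
Proof.
move=> us s' C' us' ss'.
have s's x : x \in s -> x \notin s' by apply: contraL => /ss'.
rewrite rect_cat// !PP//.
  rewrite big_cat/=; congr (_ * _)%E; apply: eq_big_seq => x xs; first by rewrite xs.
  by rewrite (negPf (ss' _ xs)).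
rewrite cat_uniq us us' andbT; apply/hasPn => x /ss' //.
Qed.

(* The coordinates of the support of [B] are split according to their value one at a time, and
   the constraint so obtained is moved into the rectangle. When none is left, [B] is trivial. *)
Let rect_indep_supported A F : measurable (A : set (bits I)) -> rect_indep A F ->
  forall F' B s C, uniq F' -> (forall x, x \in F' -> x \notin F) ->
    supported F' B -> uniq s -> (forall x, x \in s -> x \notin F) ->
    (forall x, x \in s -> x \notin F') ->
    P (A `&` (B `&` rectangle s C)) = (P A * P (B `&` rectangle s C))%E.
Proof.
move=> mA hA; elim=> [|x F' IH] B s C.
  move=> _ _ /supported_nil[->|->] us sF _; first by rewrite !setTI; exact: hA.
  by rewrite !set0I setI0 measure0 mule0.
move=> /= /andP[xF' uF'] F'F hB us sF sF'.
have xs : x \notin s by apply/negP => /sF'; rewrite mem_head.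
pose piece b := [set w | B (update x b w)] `&`
  rectangle (x :: s) (fun y => if y == x then [set b] else C y).
have mpiece b : measurable (piece b : set (bits I)).
  apply: measurableI; last exact: measurable_rect.
  by apply: supported_measurable; exact: supported_update hB.
have Bpiece : B `&` rectangle s C = piece true `|` piece false.
  rewrite {1}(set_split x B) (setI_update B x true) (setI_update B x false) setIUl /piece -!setIA.
  have e b : [set w | w x = b] `&` rectangle s C =
      rectangle (x :: s) (fun y => if y == x then [set b] else C y).
    apply/seteqP; split => w /=.
      move=> [wx h] y; rewrite inE; case: eqP => [-> _|_ /= ys]; first exact: wx.
      exact: h.
    move=> h; split; first by have := h x (mem_head _ _); rewrite eqxx.
    move=> y ys; have := h y; rewrite inE ys orbT => /(_ isT).
    by case: eqP => // yx; move: xs; rewrite -yx ys.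
  by rewrite !e.
have disj : piece true `&` piece false = set0.
  apply/seteqP; split => // w [[_ /(_ x (mem_head _ _))] + [_ /(_ x (mem_head _ _))]].
  by rewrite /= !eqxx /= => ->.
have step b : P (A `&` piece b) = (P A * P (piece b))%E.
  apply: IH => //.
  - by move=> y yF'; apply: F'F; rewrite inE yF' orbT.
  - exact: supported_update.
  - by rewrite /= xs.
  - move=> y; rewrite inE => /orP[/eqP ->|/sF//].
    by apply: F'F; rewrite mem_head.
  - move=> y; rewrite inE => /orP[/eqP ->//|/sF'].
    by rewrite inE negb_or => /andP[].
have PU (X Y : set (I -> bool)) : measurable (X : set (bits I)) ->
    measurable (Y : set (bits I)) -> X `&` Y = set0 -> P (X `|` Y) = (P X + P Y)%E.
  by move=> mX mY XY; exact: measureU.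
rewrite Bpiece setIUr PU; first last.
- by rewrite setIACA disj setI0.
- by apply: measurableI.
- by apply: measurableI.
by rewrite (PU _ _ (mpiece true) (mpiece false) disj) !step ge0_muleDr ?measure_ge0.
Qed.

(** The product formula gives the independence of two rectangles. Splitting coordinates
    replaces one of the rectangles by a local event, and a second application replaces
    the other one. *)
Lemma local_indep Q Q' A B : Q `&` Q' = set0 -> local Q A -> local Q' B ->
  P (A `&` B) = (P A * P B)%E.
Proof.
move=> QQ' [F0 F0Q hA0] [G0 G0Q hB0].
have [F uF [FQ hA]] : exists2 F : seq I, uniq F & (forall x, x \in F -> Q x) /\ supported F A.
  exists (undup F0); first exact: undup_uniq.
  split=> [x|w w' e]; first by rewrite mem_undup; exact: F0Q.
  by apply: hA0 => x xF; apply: e; rewrite mem_undup.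
have [G uG [GQ hB]] : exists2 F : seq I, uniq F & (forall x, x \in F -> Q' x) /\ supported F B.
  exists (undup G0); first exact: undup_uniq.
  split=> [x|w w' e]; first by rewrite mem_undup; exact: G0Q.
  by apply: hB0 => x xF; apply: e; rewrite mem_undup.
have FG x : x \in F -> x \notin G.
  move=> /FQ Qx; apply/negP => /GQ Q'x.
  by have : (Q `&` Q') x by []; rewrite QQ'.
have GF x : x \in G -> x \notin F by apply: contraL => /FG.
have rT : rectangle [::] (fun=> setT) = setT :> set (I -> bool).
  by apply/seteqP; split.
have hAF : rect_indep A F.
  move=> s C us sF; rewrite setIC.
  have := @rect_indep_supported _ s (measurable_rect s C) (rect_indep_rect C us)
    F A [::] (fun=> setT) uF.
  rewrite rT setIT => ->//; first by rewrite muleC.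
  by move=> x; apply: contraL => /sF.
have := @rect_indep_supported _ F (supported_measurable hA) hAF G B
  [::] (fun=> setT) uG GF hB.
by rewrite rT setIT; apply.
Qed.

Definition pr A : R := fine (P A).

Lemma prE Q A : local Q A -> P A = (pr A)%:E.
Proof. by move=> /local_measurable mA; rewrite /pr fineK// fin_num_measure. Qed.

Lemma pr_ge0 A : 0 <= pr A. Proof. by rewrite /pr fine_ge0 ?measure_ge0. Qed.

Lemma prI Q Q' A B : Q `&` Q' = set0 -> local Q A -> local Q' B ->
  pr (A `&` B) = pr A * pr B.
Proof.
move=> QQ' lA lB; rewrite {1}/pr (local_indep QQ' lA lB) fineM//;
  apply: fin_num_measure; [exact: local_measurable lA|exact: local_measurable lB].
Qed.

Lemma prC Q A : local Q A -> pr (~` A) = 1 - pr A.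
Proof.
move=> lA; rewrite /pr probability_setC; last exact: local_measurable lA.
by rewrite fineB// fin_num_measure//; exact: local_measurable lA.
Qed.

Lemma prU Q A B : local Q A -> local Q B -> pr (A `|` B) <= pr A + pr B.
Proof.
move=> lA lB; rewrite -lee_fin EFinD -(prE lA) -(prE lB) -(prE (localU lA lB)).
by apply: measureU2; [exact: local_measurable lA|exact: local_measurable lB].
Qed.

Lemma pr_all (J : eqType) (js : seq J) (Q : J -> set I) (A : J -> set (I -> bool)) :
  uniq js ->
  {in js &, forall j k, forall x, Q j x -> Q k x -> j = k} ->
  (forall j, j \in js -> local (Q j) (A j)) ->
  pr [set w | forall j, j \in js -> A j w] = \prod_(j <- js) pr (A j).
Proof.
elim: js => [|j js IH] /=.
  move=> _ _ _; rewrite big_nil (_ : [set _ | _] = setT).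
    by rewrite /pr probability_setT.
  by apply/seteqP; split.
move=> /andP[jjs ujs] Qd lA.
pose Q' := [set x | exists2 k, k \in js & Q k x].
have QQ' : Q j `&` Q' = set0.
  apply/seteqP; split => // x [Qjx [k kjs Qkx]].
  have jk : j = k by apply: Qd Qjx Qkx; rewrite ?mem_head// inE kjs orbT.
  by move: jjs; rewrite jk kjs.
rewrite (_ : [set _ | _] = A j `&` [set w | forall j, j \in js -> A j w]).
  rewrite (@prI (Q j) Q')//.
  - rewrite big_cons IH//.
      by move=> k l kjs ljs x; apply: Qd; rewrite inE ?kjs ?ljs orbT.
    by move=> k kjs; apply: lA; rewrite inE kjs orbT.
  - by apply: lA; rewrite mem_head.
  - apply: local_all => k kjs; apply: localS (lA _ _); last by rewrite inE kjs orbT.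
    by move=> x Qk; exists k.
apply/seteqP; split => w /=.
  by move=> hw; split => [|k ks]; apply: hw; rewrite inE ?eqxx ?ks ?orbT.
by move=> [Aj As] k; rewrite inE => /orP[/eqP ->|/As].
Qed.

Lemma pr_coordinate (x : I) : pr [set w | w x] = fine (mu x [set true]).
Proof.
have <- : rectangle [:: x] (fun=> [set true]) = [set w | w x].
  by rewrite rectangle1; apply/seteqP; split.
by rewrite /pr PP// big_seq1.
Qed.

End independence.

(** * Infinite paths and hierarchical percolation *)

Section infinite_paths.
Variables (T : choiceType) (e : rel T).

(* The endpoint [x] has to avoid [V] too: this is what makes the path built below injective. *)
Let reach (V : seq T) (x : T) : set T :=
  [set z | exists p, [/\ path e x p, last x p = z & all (fun y => y \notin V) (x :: p)]].

(** Koenig's lemma. The path is extended so that infinitely many vertices stay within reach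
    of its tip along paths that avoid what it has already visited: since the tip has
    finitely many neighbours, one of them inherits this property. *)
Lemma infinite_path (x : T) :
  (forall y, finite_set [set z | e y z]) ->
  infinite_set [set z | exists p, path e x p /\ last x p = z] ->
  exists g : nat -> T, [/\ g 0%N = x, injective g & forall i, e (g i) (g i.+1)].
Proof.
move=> fin inf.
have next V y : y \notin V -> infinite_set (reach V y) ->
    exists z, [/\ e y z, z \notin y :: V & infinite_set (reach (y :: V) z)].
  move=> yV infy; apply: contrapT => /forallNP nz; apply: infy.
  apply: (@sub_finite_set _ _
    ([set y] `|` \bigcup_(z in [set z | e y z /\ z \notin y :: V]) reach (y :: V) z)).
    move=> z [p [+ + /= /andP[_]]]; case/shortenP=> q pq uq qp lz pV.
    case: q pq uq qp lz => [|z' q] /=; first by left.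
    move=> /andP[yz' pq] /and3P[yq z'q uq] qp lz; right; exists z' => /=.
      split => //; move: yq; rewrite !inE !negb_or eq_sym => /andP[-> _] /=.
      by apply: (allP pV); apply: qp; rewrite mem_head.
    exists q; split => //; apply/allP => v vq; rewrite inE negb_or.
    rewrite (allP pV) ?andbT; last exact: qp.
    by apply/eqP => vy; move: yq; rewrite -vy vq.
  rewrite finite_setU; split; first exact: finite_set1.
  apply: bigcup_finite; first by apply: sub_finite_set (fin y) => z [].
  by move=> z [yz zV]; apply: contrapT => h; exact: (nz z).
have /choice[f hf] (s : seq T) : exists z, forall y V, s = y :: V -> y \notin V ->
    infinite_set (reach V y) -> [/\ e y z, z \notin s & infinite_set (reach s z)].
  case: s => [|y V]; first by exists x.
  have [[yV infy]|h] := pselect (y \notin V /\ infinite_set (reach V y)).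
    by have [z hz] := next V y yV infy; exists z => _ _ [<- <-].
  by exists x => _ _ [<- <-] yV infy; case: h.
pose state k := iter k (fun s => f s :: s) [:: x].
pose g k := head x (state k).
have stateE k : state k = g k :: behead (state k) by case: k.
have good k : g k \notin behead (state k) /\ infinite_set (reach (behead (state k)) (g k)).
  elim: k => [|k [IH1 IH2]].
    split => //; apply: sub_infinite_set inf => z [p [xp lp]]; exists p; split => //.
    exact/allP.
  by have [_ h1 h2] := hf _ _ _ (stateE k) IH1 IH2; split.
have stepP k : e (g k) (g k.+1) /\ g k.+1 \notin state k.
  by have [h1 h2] := good k; have [? ? _] := hf _ _ _ (stateE k) h1 h2.
have mem j k : (j <= k)%N -> g j \in state k.
  elim: k => [|k IH].
    by rewrite leqn0 => /eqP ->; rewrite mem_head.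
  rewrite leq_eqVlt => /orP[/eqP ->|/IH]; first by rewrite stateE mem_head.
  by rewrite /state /= inE => ->; rewrite orbT.
exists g; split => //; last by move=> k; case: (stepP k).
have lt j k : (j < k)%N -> g j <> g k.
  case: k => // k; rewrite ltnS => /mem jk gjk.
  by have [_] := stepP k; rewrite -gjk jk.
by move=> j k gjk; case: (ltngtP j k) => // /lt; rewrite gjk.
Qed.

End infinite_paths.

Definition cell := (nat * nat)%type.

Definition grid : seq cell := [seq (r, t) | r <- iota 0 3, t <- iota 0 3].

Lemma mem_grid (u : cell) : (u \in grid) = (u.1 < 3)%N && (u.2 < 3)%N.
Proof. by case: u => [[|[|[|r]]] [|[|[|t]]]]. Qed.

Definition subcell (s u : cell) : cell := ((3 * s.1 + u.1)%N, (3 * s.2 + u.2)%N).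

Definition next_to (s t : cell) : bool :=
  (t == (s.1.+1, s.2)) || (t == (s.1, s.2.+1)).

(** A box of level [k.+1] is a 3 by 3 array of boxes of level [k]; one bad box among the nine
    is tolerated. The pairs are listed so that the probability of the event can be
    bounded by a finite sum. *)
Fixpoint bad_box (bad : cell -> Prop) (k : nat) (s : cell) : Prop :=
  if k is k'.+1 then
    exists uv, uv \in [seq uv <- [seq (u, v) | u <- grid, v <- grid] | uv.1 != uv.2] /\
      (bad_box bad k' (subcell s uv.1) /\ bad_box bad k' (subcell s uv.2))
  else bad s.

(** The level 0 cells of a box that survive when the bad sub-boxes are discarded at every
    level. *)
Fixpoint core (bad : cell -> Prop) (k : nat) (s c : cell) : Prop :=
  if k is k'.+1 then
    exists u, [/\ u \in grid, ~ bad_box bad k' (subcell s u) & core bad k' (subcell s u) c]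
  else c = s.

(** One round of a breadth-first search in the grid deprived of [z]. *)
Definition grow (z : cell) (l : seq cell) : seq cell :=
  [seq v <- grid | (v \in l) ||
    ((v != z) && has (fun u => (u != z) && (next_to u v || next_to v u)) l)].

(** Removing one cell does not disconnect the 3 by 3 grid. The cell [(3, 3)], outside the
    grid, stands for removing nothing. *)
Lemma grid_minus_one (z : cell) (Q : cell -> cell -> Prop) :
  (forall u v, u \in grid -> v \in grid -> u != z -> v != z ->
     next_to u v -> Q u v /\ Q v u) ->
  (forall u, u \in grid -> u != z -> Q u u) ->
  (forall u v x, v \in grid -> v != z -> Q u v -> Q v x -> Q u x) ->
  z \in (3, 3)%N :: grid ->
  forall u v, u \in grid -> v \in grid -> u != z -> v != z -> Q u v.
Proof.
move=> Qadj Qrefl Qtrans zg u v ug vg uz vz.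
have h n x : x \in iter n (grow z) [:: u] -> [/\ x \in grid, x != z & Q u x].
  elim: n x => [|n IH] x /=.
    by rewrite inE => /eqP ->; split => //; exact: Qrefl.
  rewrite mem_filter => /andP[/orP[/IH //|/andP[xz /hasP[y /IH[yg yz Quy] /andP[_ xy]]]] xg].
  split => //; apply: (Qtrans _ y) => //.
  by case/orP: xy => /Qadj; case.
(* Eight rounds reach any of the at most nine cells. *)
have /allP/(_ z zg)/allP/(_ u ug)/allP/(_ v vg) : all (fun z => all (fun u => all
    (fun v => (u == z) || (v == z) || (v \in iter 8 (grow z) [:: u])) grid) grid)
    ((3, 3)%N :: grid) by vm_compute.
rewrite (negPf uz) (negPf vz) !orFb => /h[_ _ Quv]; exact: Quv.
Qed.

Section good_boxes.
Variables (bad : cell -> Prop).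
Local Notation bad_box := (bad_box bad).
Local Notation core := (core bad).

Lemma good_box_exception k s : ~ bad_box k.+1 s ->
  exists2 z, z \in (3, 3)%N :: grid &
    forall u, u \in grid -> u != z -> ~ bad_box k (subcell s u).
Proof.
move=> gs; have [[z zg bz]|nb] :=
    pselect (exists2 z, z \in grid & bad_box k (subcell s z)).
  exists z; first by rewrite inE zg orbT.
  move=> u ug uz bu; apply: gs; exists (u, z); split => //.
  by rewrite mem_filter; apply/andP; split; [exact: uz|exact: (allpairs_f pair)].
exists (3, 3)%N; first exact: mem_head.
by move=> u ug _ bu; apply: nb; exists u.
Qed.

Lemma core_nonempty k s : ~ bad_box k s -> exists c, core k s c.
Proof.
elim: k s => [|k IH] s; first by exists s.
move=> /good_box_exception[z _ hz].
have [u [ug uz]] : exists u, u \in grid /\ u != z.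
  by have [->|z0] := eqVneq z (0, 0)%N; [exists (0, 1)%N|exists (0, 0)%N; rewrite eq_sym].
have gu := hz _ ug uz; have [c hc] := IH _ gu.
by exists c, u.
Qed.

Lemma core_ge k s c : core k s c -> (3 ^ k * s.1 <= c.1)%N /\ (3 ^ k * s.2 <= c.2)%N.
Proof.
elim: k s => [|k IH] s /=; first by move=> ->; rewrite expn0 !mul1n.
move=> [u [_ _ /IH[/= h1 h2]]]; rewrite expnS; nia.
Qed.

Variable R : cell -> cell -> Prop.
Hypothesis Rrefl : forall c, R c c.
Hypothesis Rsym : forall c d, R c d -> R d c.
Hypothesis Rtrans : forall d c c', R c d -> R d c' -> R c c'.
Hypothesis Radj : forall c d, next_to c d -> ~ bad c -> ~ bad d -> R c d.

(** Inside a good box, the good sub-boxes form a connected part of the grid. Between two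
    adjacent good boxes there are three pairs of facing sub-boxes, and the two exceptions spoil
    at most two of them. *)
Lemma core_connected k s t : ~ bad_box k s -> ~ bad_box k t -> s = t \/ next_to s t ->
  forall c d, core k s c -> core k t d -> R c d.
Proof.
elim: k s t => [|k IH] s t gs gt st.
  by move=> c d /= -> ->; case: st => [->//|/Radj]; apply.
pose Q x y := forall c d, core k x c -> core k y d -> R c d.
have Qtrans y x z : ~ bad_box k y -> Q x y -> Q y z -> Q x z.
  move=> /core_nonempty[b yb] xy yz c d xc zd.
  exact: Rtrans (xy _ _ xc yb) (yz _ _ yb zd).
have within x : ~ bad_box k.+1 x -> forall u v, u \in grid -> v \in grid ->
    ~ bad_box k (subcell x u) -> ~ bad_box k (subcell x v) ->
    Q (subcell x u) (subcell x v).
  move=> gx u v ug vg gu gv.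
  have [u0|u0] := pselect (exists2 z, z \in (3, 3)%N :: grid & [/\ u != z, v != z &
      forall u, u \in grid -> u != z -> ~ bad_box k (subcell x u)]).
    move: u0 => [z zg [uz vz hz]].
    apply: (@grid_minus_one z (fun u v => Q (subcell x u) (subcell x v))) => //.
    - move=> a b ag bg az bz ab.
      have Qab : Q (subcell x a) (subcell x b).
        apply: IH; [exact: hz|exact: hz|right].
        by move: ab; rewrite /next_to /subcell /= => /orP[] /eqP -> /=;
          rewrite addnS eqxx ?orbT.
      by split => // c d xc xd; apply: Rsym; exact: Qab.
    - by move=> y yg yz; apply: IH; [exact: hz|exact: hz|left].
    - by move=> a b c bg bz; apply: Qtrans; exact: hz.
  exfalso; apply: u0; have [z zg hz] := good_box_exception gx.
  have [bz|gz] := pselect (bad_box k (subcell x z)).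
    exists z => //; split => //.
      by apply/eqP => uz; apply: gu; rewrite uz.
    by apply/eqP => vz; apply: gv; rewrite vz.
  exists (3, 3)%N; first exact: mem_head.
  split; [by apply/eqP => uz; move: ug; rewrite uz|by apply/eqP => uz; move: vg; rewrite uz|].
  by move=> y yg _; have [->//|yz] := eqVneq y z; exact: hz.
move=> c d [u [ug gu cu]] [v [vg gv dv]].
case: st => [st|st]; first by subst t; exact: within gs _ _ ug vg gu gv _ _ cu dv.
have [z _ hz] := good_box_exception gs; have [z' _ hz'] := good_box_exception gt.
suff [x [y [xg yg gx gy xy]]] : exists x y, [/\ x \in grid, y \in grid,
    ~ bad_box k (subcell s x), ~ bad_box k (subcell t y) &
    next_to (subcell s x) (subcell t y)].
  have [b hb] := core_nonempty gx; have [b' hb'] := core_nonempty gy.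
  apply: (@Rtrans b); first exact: within gs _ _ ug xg gu gx _ _ cu hb.
  apply: (@Rtrans b'); last exact: within gt _ _ yg vg gy gv _ _ hb' dv.
  by apply: IH hb hb' => //; right.
have free (a b : nat) : exists i : nat, [/\ i \in iota 0 3, i != a & i != b].
  exists (if ((0 != a) && (0 != b))%N then 0%N else
          if ((1 != a) && (1 != b))%N then 1%N else 2).
  by case: a => [|[|[|a]]]; case: b => [|[|[|b]]].
case/orP: st => /eqP te; rewrite te.
  have [i [i3 iz iz']] := free z.2 z'.2; exists (2, i)%N, (0, i)%N.
  have g1 : (2, i)%N \in grid by apply/allpairsP; exists (2, i)%N.
  have g2 : (0, i)%N \in grid by apply/allpairsP; exists (0, i)%N.
  split => //.
  - by apply: hz => //; apply: contraNneq iz => <-.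
  - by rewrite -te; apply: hz' => //; apply: contraNneq iz' => <-.
  - by rewrite /next_to /subcell /= ; apply/orP; left; apply/eqP; congr pair; lia.
have [i [i3 iz iz']] := free z.1 z'.1; exists (i, 2)%N, (i, 0)%N.
have g1 : (i, 2)%N \in grid by apply/allpairsP; exists (i, 2)%N.
have g2 : (i, 0)%N \in grid by apply/allpairsP; exists (i, 0)%N.
split => //.
- by apply: hz => //; apply: contraNneq iz => <-.
- by rewrite -te; apply: hz' => //; apply: contraNneq iz' => <-.
- by rewrite /next_to /subcell /= ; apply/orP; right; apply/eqP; congr pair; lia.
Qed.

(** The origin lies in the core of all the boxes that contain it, and each of these cores
    reaches a sub-box away from the corner. *)
Lemma good_boxes_connect : (forall k, ~ bad_box k (0, 0)%N) ->
  forall k, exists2 c, (3 ^ k <= c.1 + c.2)%N & R (0, 0)%N c.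
Proof.
move=> g k.
have core0 j : core j (0, 0)%N (0, 0)%N.
  by elim: j => //= j IH; exists (0, 0)%N; split => //; exact: g.
have [z _ hz] := good_box_exception (g k.+1).
pose u := if z == (0, 1)%N then (1, 0)%N else (0, 1)%N : cell.
have ug : u \in grid by rewrite /u; case: ifP.
have uz : u != z by rewrite /u; case: ifP => [/eqP ->//|/negbT]; rewrite eq_sym.
have gu := hz u ug uz; have [c cu] := core_nonempty gu.
exists c; last first.
  apply: (core_connected (g k.+1) (g k.+1)); [by left|exact: core0|].
  by exists u.
by have [] := core_ge cu; rewrite /u; case: ifP => /= _; lia.
Qed.

End good_boxes.

(** * Probability of bad boxes *)

Fixpoint box_support (I : Type) (Q : cell -> set I) (k : nat) (s : cell) : set I :=
  if k is k'.+1 then [set x | exists2 u, u \in grid & box_support Q k' (subcell s u) x]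
  else Q s.

Section box_probability.
Variables (R : realType) (I : eqType) (mu : I -> probability bool R).
Variable P : probability (bits I) R.
Hypothesis PP : is_product_measure mu P.
Variables (Q : cell -> set I) (bad : cell -> set (I -> bool)) (eps : R).
Hypothesis Qdisj : forall c d x, Q c x -> Q d x -> c = d.
Hypothesis bad_local : forall c, local (Q c) (bad c).
Hypothesis bad_le : forall c, pr P (bad c) <= eps.

Let bad_event k s := [set w | bad_box (fun c => bad c w) k s].

Lemma pr_exists (J : eqType) (js : seq J) (S : set I) (A : J -> set (I -> bool)) :
  (forall j, j \in js -> local S (A j)) ->
  local S [set w | exists j, j \in js /\ A j w] /\
  pr P [set w | exists j, j \in js /\ A j w] <= \sum_(j <- js) pr P (A j).
Proof.
elim: js => [|j js IH] h.
  rewrite (_ : [set _ | _] = set0).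
    split; last by rewrite big_nil /pr measure0.
    by rewrite -setCT; apply: localC; exact: localT.
  by apply/seteqP; split => // w [j []].
rewrite (_ : [set _ | _] = A j `|` [set w | exists j, j \in js /\ A j w]).
  have lj := h j (mem_head _ _).
  have [l1 l2] : local S [set w | exists j, j \in js /\ A j w] /\
      pr P [set w | exists j, j \in js /\ A j w] <= \sum_(j <- js) pr P (A j).
    by apply: IH => i ijs; apply: h; rewrite inE ijs orbT.
  split; first exact: localU.
  by rewrite big_cons; apply: le_trans (prU P lj l1) _; rewrite lerD2l.
apply/seteqP; split => w /=.
  by move=> [i []]; rewrite inE => /orP[/eqP ->|ijs] Ai; [left|right; exists i].
move=> [Aj|[i [ijs Ai]]]; first by exists j; rewrite mem_head.
by exists i; rewrite inE ijs orbT.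
Qed.

Lemma box_support_disjoint k s t x :
  box_support Q k s x -> box_support Q k t x -> s = t.
Proof.
elim: k s t => [|k IH] s t /=; first exact: Qdisj.
move=> [u ug us] [v vg vt]; have := IH _ _ us vt.
move: ug vg; rewrite !mem_grid => /andP[u1 u2] /andP[v1 v2] [h1 h2].
by rewrite (surjective_pairing s) (surjective_pairing t); congr pair; lia.
Qed.

Lemma bad_event_local k s : local (box_support Q k s) (bad_event k s).
Proof.
elim: k s => [|k IH] s; first exact: bad_local.
apply: (pr_exists _).1 => -[u v].
rewrite mem_filter => /andP[_ /allpairsP[[a b] /= [ag bg [-> ->]]]].
rewrite -[X in local X _]setUid; apply: localI.
  by apply: localS (IH (subcell s a)) => x hx; exists a.
by apply: localS (IH (subcell s b)) => x hx; exists b.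
Qed.

(** A bad box contains two bad sub-boxes, which are independent: the probability is squared at
    each level. *)
Lemma pr_bad_eventS k s x : (forall t, pr P (bad_event k t) <= x) ->
  pr P (bad_event k.+1 s) <= 72%:R * x ^+ 2.
Proof.
move=> hx; pose pairs := [seq uv <- [seq (u, v) | u <- grid, v <- grid] | uv.1 != uv.2].
have pairs_local uv : uv \in pairs -> local (box_support Q k.+1 s)
    (bad_event k (subcell s uv.1) `&` bad_event k (subcell s uv.2)).
  case: uv => u v.
  rewrite mem_filter => /andP[_ /allpairsP[[a b] /= [ag bg [-> ->]]]].
  rewrite -[X in local X _]setUid; apply: localI.
    by apply: localS (bad_event_local k (subcell s a)) => y hy; exists a.
  by apply: localS (bad_event_local k (subcell s b)) => y hy; exists b.
apply: le_trans (pr_exists pairs_local).2 _.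
(* 72 is the number of ordered pairs of distinct cells of the grid. *)
have -> : 72%:R * x ^+ 2 = \sum_(uv <- pairs) x ^+ 2.
  by rewrite big_const_seq count_predT iter_addr_0 mulr_natl.
rewrite big_seq [leRHS]big_seq; apply: ler_sum => -[u v].
rewrite mem_filter => /andP[uv _].
have sub_inj a b : subcell s a = subcell s b -> a = b.
  by case: a b => [a1 a2] [b1 b2] [] h1 h2; congr pair; lia.
rewrite (prI PP _ (bad_event_local _ _) (bad_event_local _ _)).
  by rewrite expr2; apply: ler_pM; rewrite ?pr_ge0.
apply/seteqP; split => // y [h1 h2].
by move: uv; rewrite (sub_inj _ _ (box_support_disjoint h1 h2)) eqxx.
Qed.

Hypothesis eps_small : 72%:R * eps <= 2^-1.

(** Doubly exponential decay, stated in the weaker geometric form that is enough for the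
    sum over the levels. *)
Lemma pr_bad_event k s : 72%:R * pr P (bad_event k s) <= (72%:R * eps) ^+ k.+1.
Proof.
have eps0 : 0 <= eps by apply: le_trans (bad_le (0, 0)%N); exact: pr_ge0.
have y0 : 0 <= 72%:R * eps by rewrite mulr_ge0.
elim: k s => [|k IH] s.
  by rewrite expr1 ler_pM2l//; exact: bad_le.
have hk t : pr P (bad_event k t) <= (72%:R * eps) ^+ k.+1 / 72%:R.
  by rewrite ler_pdivlMr// mulrC.
apply: (@le_trans _ _ (72%:R * (72%:R * ((72%:R * eps) ^+ k.+1 / 72%:R) ^+ 2))).
  by rewrite ler_pM2l//; exact: pr_bad_eventS.
have y_small := eps_small; set y := 72%:R * eps in y0 y_small *.
have -> : 72%:R * (72%:R * (y ^+ k.+1 / 72%:R) ^+ 2) = (y ^+ k.+1) ^+ 2 :> R by field.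
rewrite -exprM; apply: ler_wiXn2l => //; last by lia.
by apply: le_trans y_small _; lra.
Qed.

Lemma pr_no_bad_box :
  ((1 - 2 * (72%:R * eps))%:E <=
    P [set w | forall k, ~ bad_box (fun c => bad c w) k (0, 0)%N])%E /\
  measurable ([set w | forall k, ~ bad_box (fun c => bad c w) k (0, 0)%N] : set (bits I)).
Proof.
have eps0 : 0 <= eps by apply: le_trans (bad_le (0, 0)%N); exact: pr_ge0.
have y_small := eps_small; set y := 72%:R * eps in y_small *.
have y0 : 0 <= y by rewrite mulr_ge0.
have -> : [set w | forall k, ~ bad_box (fun c => bad c w) k (0, 0)%N] =
    ~` \bigcup_k bad_event k (0, 0)%N.
  apply/seteqP; split => w /= h; first by move=> [k _]; exact: h.
  by move=> k hk; apply: h; exists k.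
have mb k : measurable (bad_event k (0, 0)%N : set (bits I)).
  exact: local_measurable (bad_event_local _ _).
have mU : measurable (\bigcup_k bad_event k (0, 0)%N : set (bits I)).
  exact: bigcupT_measurable.
split; last exact: measurableC.
have PU : (P (\bigcup_k bad_event k (0, 0)%N) <= (2 * y)%:E)%E.
  apply: le_trans (measure_sigma_subadditive P mb mU _) _ => //.
  apply: lime_le; first by apply: is_cvg_nneseries.
  apply: nearW => n.
  rewrite (eq_bigr (fun k => (pr P (bad_event k (0, 0)%N))%:E)); last first.
    by move=> k _; exact: (prE P (bad_event_local _ _)).
  rewrite sumEFin lee_fin.
  (* This bound on the geometric sum passes through the induction because [y <= 1 / 2]. *)
  apply: (@le_trans _ _ (2 * y * (1 - y ^+ n))); last first.
    rewrite -[leRHS]mulr1; apply: ler_wpM2l; first by rewrite mulr_ge0.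
    by rewrite gerBl exprn_ge0.
  elim: n => [|n IH]; first by rewrite big_geq// expr0 subrr mulr0.
  have hn : pr P (bad_event n (0, 0)%N) <= y ^+ n.+1.
    apply: le_trans (pr_bad_event n (0, 0)%N).
    by rewrite ler_peMl ?pr_ge0// ler1n.
  rewrite big_nat_recr//=; apply: le_trans (lerD IH hn) _.
  have := exprn_ge0 n y0; rewrite exprS; move: (y ^+ n) => z z0.
  have : 0 <= y * z * (2^-1 - y) by rewrite !mulr_ge0// subr_ge0.
  by lra.
rewrite probability_setC// EFinB; apply: leeB => //.
Qed.

End box_probability.

(** * Legs and detours *)

Definition vtx (l r : nat) : vertex := (l%:Z, r%:Z).

(* The index [n] stands for length [n.+1], lengths being positive. *)
Definition hbond (l r n : nat) : bond :=
  inr ((l%:Z, r%:Z), exist (fun k => (0 < k)%N) n.+1 isT).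

Definition vbond (l r : nat) : bond := inl (l%:Z, r%:Z).

Lemma hbond_inj l r n l' r' n' :
  hbond l r n = hbond l' r' n' -> [/\ l = l', r = r' & n = n'].
Proof. by case=> -> -> ->. Qed.

Lemma vbond_inj l r l' r' : vbond l r = vbond l' r' -> l = l' /\ r = r'.
Proof. by case=> -> ->. Qed.

Lemma endpoints_hbond l r n : endpoints (hbond l r n) = (vtx l r, vtx (l + n.+1) r).
Proof. by rewrite /vtx PoszD. Qed.

Lemma endpoints_vbond l r : endpoints (vbond l r) = (vtx l r, vtx l r.+1).
Proof. by rewrite /vtx -addn1 PoszD. Qed.

Section connection.
Implicit Types (w : bond -> bool) (x y z : vertex).

(** Koenig's lemma needs finite degrees, so paths are built from bonds of bounded
    length. *)
Definition restrict (L : nat) w : bond -> bool :=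
  fun e => w e && (if e is inr (_, n) then (val n <= L)%N else true).

Definition step w : rel vertex := fun x y => `[< open_step w x y >].

Definition joined w x y := exists p, path (step w) x p /\ last x p = y.

Lemma joined_refl w x : joined w x x. Proof. by exists [::]. Qed.

Lemma joined_trans w y x z : joined w x y -> joined w y z -> joined w x z.
Proof.
move=> [p [xp lp]] [q [yq lq]]; exists (p ++ q).
by rewrite cat_path last_cat lp xp yq lq.
Qed.

Lemma joined_bond w e x y : w e -> endpoints e = (x, y) ->
  joined w x y /\ joined w y x.
Proof.
move=> we exy; split; [exists [:: y]|exists [:: x]]; split => //=; rewrite andbT;
  by apply/asboolP; exists e; split; [|tauto].
Qed.

Lemma joined_sym w x y : joined w x y -> joined w y x.
Proof.
move=> [p [+ <-]]; elim: p x => [|z p IH] x /=; first by move=> _; exact: joined_refl.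
move=> /andP[xz zp]; apply: joined_trans (IH _ zp) _.
exists [:: x]; split => //=; rewrite andbT; apply/asboolP.
by move/asboolP: xz => [e [we h]]; exists e; split => //; tauto.
Qed.

Lemma finite_neighbours L w x : finite_set [set y | step (restrict L w) x y].
Proof.
apply: (@sub_finite_set _ _ ([set` [:: (x.1, x.2 + 1); (x.1, x.2 - 1)]] `|`
  ([set` [seq (x.1 + i%:Z, x.2) | i <- iota 0 L.+1]] `|`
   [set` [seq (x.1 - i%:Z, x.2) | i <- iota 0 L.+1]]))); last first.
  by rewrite !finite_setU; do !split; exact: finite_seq.
move=> y /asboolP[e [/andP[_ eL] exy]].
case: e eL exy => [z|[z n]] /=.
  move=> _ [] [<- <-]; left; rewrite /= !inE; first by rewrite eqxx.
  by rewrite /= addrK -surjective_pairing eqxx orbT.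
move=> nL [] [<- <-]; right.
  have nI : val n \in iota 0 L.+1 by rewrite mem_iota.
  by left; exact: (map_f (fun i : nat => (z.1 + i%:Z, z.2)) nI).
have nI : val n \in iota 0 L.+1 by rewrite mem_iota.
right; have := map_f (fun i : nat => (z.1 + (val n)%:Z - i%:Z, z.2)) nI.
by rewrite addrK -surjective_pairing.
Qed.

Lemma infinite_cluster L w :
  (forall k, exists l r, (k <= l + r)%N /\ joined (restrict L w) (vtx 0 0) (vtx l r)) ->
  origin_to_infinity w.
Proof.
move=> far; have [||g [g0 gi gs]] := @infinite_path _ (step (restrict L w)) (vtx 0 0).
- by move=> y; exact: finite_neighbours.
- move=> /finite_seqP[s sE].
  pose height (v : vertex) := (`|v.1| + `|v.2|)%N.
  have [l [r [lr [p hp]]]] := far (\max_(v <- s) height v).+1.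
  have vs : vtx l r \in s.
    by have : [set` s] (vtx l r) by rewrite -sE; exists p.
  have h : (height (vtx l r) <= \max_(v <- s) height v)%N.
    exact: (leq_bigmax_seq (F := height)).
  by have := leq_trans lr h; rewrite /height /= ltnn.
exists g; split => // i.
by have /asboolP[e [/andP[we _] he]] := gs i; exists e.
Qed.

End connection.

(** A jump by [N] along a row, made of a bond of length [N + n] forwards and one of length [n]
    backwards. The bonds of distinct [n] being distinct, the attempts are
    independent. *)
Definition leg (N M l r : nat) : set (bond -> bool) :=
  ~` [set w | forall n, n \in iota 0 M -> ~ (w (hbond l r (N + n)) /\ w (hbond (l + N) r n))].

Definition leg_support (N M l r : nat) : set bond :=
  [set b | exists2 n, (n < M)%N & b = hbond l r (N + n) \/ b = hbond (l + N) r n].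

Lemma legP N M l r w : leg N M l r w ->
  exists2 n, (n < M)%N & w (hbond l r (N + n)) /\ w (hbond (l + N) r n).
Proof.
move=> h; apply: contrapT => nh; apply: h => n; rewrite mem_iota => /= nM hn.
by apply: nh; exists n.
Qed.

Lemma leg_joined N M L l r w : (N + M <= L)%N -> leg N M l r w ->
  joined (restrict L w) (vtx l r) (vtx (l + N) r).
Proof.
move=> NML /legP[n nM [w1 w2]].
have r1 : restrict L w (hbond l r (N + n)) by rewrite /restrict w1 /=; lia.
have r2 : restrict L w (hbond (l + N) r n) by rewrite /restrict w2 /=; lia.
have [c1 _] := joined_bond r1 (endpoints_hbond _ _ _).
have [_ c2] := joined_bond r2 (endpoints_hbond _ _ _).
by apply: joined_trans c1 _; rewrite -addnS addnA.
Qed.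

Lemma leg_local N M l r : local (leg_support N M l r) (leg N M l r).
Proof.
apply: localC; apply: local_all => n; rewrite mem_iota => /= nM.
apply: localC; rewrite -[X in local X _]setUid.
apply: localI; apply: localS (local_coordinate _) => _ ->; exists n => //; by [left|right].
Qed.

Definition open_vbond (l r : nat) : set (bond -> bool) := [set w | w (vbond l r)].

Lemma open_vbond_local l r : local [set vbond l r] (open_vbond l r).
Proof. exact: local_coordinate. Qed.

Lemma open_vbond_joined L l r w : open_vbond l r w ->
  joined (restrict L w) (vtx l r) (vtx l r.+1) /\
  joined (restrict L w) (vtx l r.+1) (vtx l r).
Proof.
move=> h; apply: joined_bond (endpoints_vbond l r).
by rewrite /restrict h.
Qed.

(** The detours of a lattice edge use the indices of one class modulo 4, determined by its
    direction and by the parity of its starting cell. Two edges that share an endpoint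
    therefore never compete for a bond. *)
Definition class_index (c : cell) (right : bool) (j : nat) : nat :=
  (4 * j + (if right then c.1 %% 2 else 2 + c.2 %% 2))%N.

Lemma class_index_lt (c : cell) (right : bool) (j m : nat) :
  (j < m)%N -> (class_index c right j < 4 * m)%N.
Proof. by rewrite /class_index; case: right; lia. Qed.

Section detours.
Variables (N M : nat -> nat) (m : nat).
(* [N i] is a shift and [M i] the number of attempts to jump by it. Under this hypothesis the length
   [N i + n] of a forward bond determines [i]. *)
Hypothesis NS : forall i, (N i + M i < N i.+1)%N.

Lemma sparse i j : (i < j)%N -> (N i + M i < N j)%N.
Proof.
elim: j => // j IH; rewrite ltnS leq_eqVlt => /orP[/eqP ->|/IH h]; first exact: NS.
by have := NS j; lia.
Qed.

Lemma sparse_inj i j n n' : (n < M i)%N -> (n' < M j)%N ->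
  (N i + n = N j + n')%N -> i = j.
Proof. by move=> ni nj; case: (ltngtP i j) => // /sparse; lia. Qed.

(** The period [N (4 * m)] exceeds all the jumps [N i] of the detours, so the points where
    detours leave their row are told apart by their residues. *)
Local Notation D := (N (4 * m)).

Definition xpos (c : cell) : nat := (c.1 * D)%N.
(** The odd rows carry the long jumps of the horizontal detours, away from the spurs. *)
Definition ypos (c : cell) : nat := (2 * c.2)%N.
Definition site (c : cell) : vertex := vtx (xpos c) (ypos c).

Definition spur (i l r : nat) : set (bond -> bool) := leg (N i) (M i) l r.
Definition spur_support (i l r : nat) : set bond := leg_support (N i) (M i) l r.

(** To go from a site to its neighbour, jump aside by [N i], move in the required direction, and
    jump back. The two sites are fixed, whereas [i] varies: this gives many ways of making the
    same move. The horizontal move takes place one row higher. *)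
Definition detour (c : cell) (right : bool) (j : nat) : set (bond -> bool) :=
  let i := class_index c right j in let x := xpos c in let y := ypos c in
  if right then
    spur i x y `&` (open_vbond (x + N i) y `&` (spur (4 * m) (x + N i) y.+1 `&`
      (open_vbond (x + N i + D) y `&` spur i (x + D) y)))
  else
    spur i x y `&` (open_vbond (x + N i) y `&`
      (open_vbond (x + N i) y.+1 `&` spur i x y.+2)).

Definition detour_support (c : cell) (right : bool) (j : nat) : set bond :=
  let i := class_index c right j in let x := xpos c in let y := ypos c in
  if right then
    spur_support i x y `|` ([set vbond (x + N i) y] `|` (spur_support (4 * m) (x + N i) y.+1 `|`
      ([set vbond (x + N i + D) y] `|` spur_support i (x + D) y)))
  else
    spur_support i x y `|` ([set vbond (x + N i) y] `|`
      ([set vbond (x + N i) y.+1] `|` spur_support i x y.+2)).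

Lemma detour_local c right j : local (detour_support c right j) (detour c right j).
Proof.
rewrite /detour /detour_support; case: right;
  by repeat (apply: localI; [exact: leg_local || exact: open_vbond_local|]);
     exact: leg_local.
Qed.

Definition max_length := (D + M (4 * m))%N.

Lemma detour_joined c right j w : (j < m)%N -> detour c right j w ->
  joined (restrict max_length w) (site c)
    (site (if right then (c.1.+1, c.2) else (c.1, c.2.+1))).
Proof.
move=> jm; rewrite /detour; have := class_index_lt c right jm.
move: (class_index c right j) => i i4.
have iL : (N i + M i <= max_length)%N by rewrite /max_length; have := sparse i4; lia.
case: right => /=.
  move=> [h1 [h2 [h3 [h4 h5]]]].
  apply: joined_trans (leg_joined iL h1) _.
  apply: joined_trans (open_vbond_joined max_length h2).1 _.
  apply: joined_trans (leg_joined (leqnn _) h3) _.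
  apply: joined_trans (open_vbond_joined max_length h4).2 _.
  apply: joined_sym; have := leg_joined iL h5.
  by rewrite addnAC /site /xpos /ypos /= (mulSn c.1 D) [(D + _)%N]addnC.
move=> [h1 [h2 [h3 h4]]].
apply: joined_trans (leg_joined iL h1) _.
apply: joined_trans (open_vbond_joined max_length h2).1 _.
apply: joined_trans (open_vbond_joined max_length h3).1 _.
apply: joined_sym; have := leg_joined iL h4.
by rewrite /site /xpos /ypos /= mulnS.
Qed.

Hypothesis N0 : (0 < N 0)%N.

Lemma sparse_gt0 i : (0 < N i)%N.
Proof. by case: i => // i; have := @sparse 0 i.+1 isT; lia. Qed.

(** Where a bond of a detour lies: either it starts in the column of the tip of a spur of index
    [i], whose residue modulo the period is [N i], or it is the first bond of such a spur, and then
    its length betrays [i]. *)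
Definition located (b : bond) (a r i : nat) : Prop :=
  [\/ b = vbond (a * D + N i) r, exists n, b = hbond (a * D + N i) r n |
      exists2 n, (n < M i)%N & b = hbond (a * D) r (N i + n)].

Lemma euclid a x a' x' : (x < D)%N -> (x' < D)%N ->
  (a * D + x = a' * D + x')%N -> a = a' /\ x = x'.
Proof.
move=> xD xD' h; have xx : x = x'.
  by have := congr1 (fun z => z %% D)%N h; rewrite !modnMDl !modn_small.
split => //; have D0 : (0 < D)%N by exact: sparse_gt0.
apply/eqP; rewrite -(eqn_pmul2r D0); apply/eqP; lia.
Qed.

Lemma located_inj b a r i a' r' i' : (i < 4 * m)%N -> (i' < 4 * m)%N ->
  located b a r i -> located b a' r' i' -> [/\ a = a', r = r' & i = i'].
Proof.
move=> im im'; have D0 := sparse_gt0 (4 * m).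
have := sparse im; have := sparse im'; have := sparse_gt0 i; have := sparse_gt0 i'.
move=> g g' s s'.
have inj : N i = N i' -> i = i' by case: (ltngtP i i') => // /sparse; lia.
have iD : (N i < D)%N by lia.
have iD' : (N i' < D)%N by lia.
move=> [->|[n ->]|[n nM ->]] [|[n' //]|[n' n'M]] //.
- by move=> /vbond_inj[h ->]; have [-> /inj ->] := euclid iD iD' h.
- by move=> /hbond_inj[h -> _]; have [-> /inj ->] := euclid iD iD' h.
- move=> /hbond_inj[h _ _].
  by have [] := @euclid a (N i) a' 0%N iD D0 _; lia.
- move=> /hbond_inj[h _ _].
  by have [] := @euclid a 0%N a' (N i') D0 iD' _; lia.
- move=> /hbond_inj[h -> hn].
  by have [|-> _] := @euclid a 0%N a' 0%N D0 D0 _; [lia|rewrite (sparse_inj nM n'M hn)].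
Qed.

Lemma detour_located c right j b : detour_support c right j b ->
  exists a r, [/\ located b a r (class_index c right j),
    (c.1 <= a <= c.1 + right)%N & (2 * c.2 <= r <= 2 * c.2 + 2 - right)%N].
Proof.
rewrite /detour_support; move: (class_index c right j) => i; rewrite /spur_support.
case: right => /=.
  move=> [[n nM [->|->]]|[->|[[n nM [->|->]]|[->|[n nM [->|->]]]]]]; rewrite /xpos /ypos.
  - by exists c.1, (2 * c.2)%N; split; [apply: Or33; exists n|lia|lia].
  - by exists c.1, (2 * c.2)%N; split; [apply: Or32; exists n|lia|lia].
  - by exists c.1, (2 * c.2)%N; split; [apply: Or31|lia|lia].
  - by exists c.1, (2 * c.2).+1; split; [apply: Or32; exists (D + n)%N|lia|lia].
  - exists c.1.+1, (2 * c.2).+1; split; [apply: Or32; exists n|lia|lia].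
    by congr hbond; rewrite (mulSn c.1 D); lia.
  - exists c.1.+1, (2 * c.2)%N; split; [apply: Or31|lia|lia].
    by congr vbond; rewrite (mulSn c.1 D); lia.
  - exists c.1.+1, (2 * c.2)%N; split; [apply: Or33; exists n|lia|lia] => //.
    by congr hbond; rewrite (mulSn c.1 D); lia.
  - exists c.1.+1, (2 * c.2)%N; split; [apply: Or32; exists n|lia|lia].
    by congr hbond; rewrite (mulSn c.1 D); lia.
move=> [[n nM [->|->]]|[->|[->|[n nM [->|->]]]]]; rewrite /xpos /ypos.
- by exists c.1, (2 * c.2)%N; split; [apply: Or33; exists n|lia|lia].
- by exists c.1, (2 * c.2)%N; split; [apply: Or32; exists n|lia|lia].
- by exists c.1, (2 * c.2)%N; split; [apply: Or31|lia|lia].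
- by exists c.1, (2 * c.2).+1; split; [apply: Or31|lia|lia].
- by exists c.1, (2 * c.2).+2; split; [apply: Or33; exists n|lia|lia].
- by exists c.1, (2 * c.2).+2; split; [apply: Or32; exists n|lia|lia].
Qed.

(** The index read off a bond gives the direction and the parity of the cell; the position of
    the bond leaves two adjacent candidates for the cell, and parity decides. *)
Lemma detour_support_disjoint c right j c' right' j' b : (j < m)%N -> (j' < m)%N ->
  detour_support c right j b -> detour_support c' right' j' b ->
  [/\ c = c', right = right' & j = j'].
Proof.
move=> jm jm' /detour_located[a [r [t ha hr]]] /detour_located[a' [r' [t' ha' hr']]].
have [aa rr] := located_inj (class_index_lt c right jm) (class_index_lt c' right' jm') t t'.
subst a' r'; rewrite /class_index.
case: c c' ha hr ha' hr' {t t'} => [c1 c2] [d1 d2] /=.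
case: right; case: right' => /= ha hr ha' hr' h.
- by split => //; [congr pair; lia|lia].
- by exfalso; lia.
- by exfalso; lia.
- by split => //; [congr pair; lia|lia].
Qed.

End detours.

(** * Probability of legs and detours *)

(** A division-free form of the bound of the product by the inverse of [1 + sum]. It gives a
    uniform lower bound for the probability of a leg, and it shows that many
    independent detours hardly ever all fail. *)
Lemma prod_one_minus_le (R : realType) (J : eqType) (js : seq J) (x : J -> R) :
  (forall j, j \in js -> 0 <= x j <= 1) ->
  \prod_(j <- js) (1 - x j) * (1 + \sum_(j <- js) x j) <= 1.
Proof.
elim: js => [|j js IH] h; first by rewrite !big_nil addr0 mulr1.
have /andP[x0 x1] := h j (mem_head _ _).
have hs i : i \in js -> 0 <= x i <= 1 by move=> ijs; apply: h; rewrite inE ijs orbT.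
have s0 : 0 <= \sum_(i <- js) x i.
  by rewrite big_seq sumr_ge0// => i /hs /andP[].
have p0 : 0 <= \prod_(i <- js) (1 - x i).
  by rewrite big_seq prodr_ge0// => i /hs /andP[_]; rewrite subr_ge0.
have := IH hs; rewrite !big_cons; move: s0 p0.
move: (\sum_(i <- js) x i) (\prod_(i <- js) (1 - x i)) => s p s0 p0 ps.
apply: le_trans ps; rewrite [_ * p]mulrC -mulrA; apply: ler_wpM2l => //.
have : 0 <= x j * (s + x j) by rewrite mulr_ge0// addr_ge0.
lra.
Qed.

Section detour_probability.
Variables (R : realType) (mu : bond -> probability bool R) (P : probability (bits bond) R).
Hypothesis PP : is_product_measure mu P.
Variables (delta : R) (p : nat -> R) (L : nat).
Hypothesis delta01 : 0 < delta <= 1.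
Hypothesis p01 : forall n, 0 <= p n.+1 <= 1.
Hypothesis mu_vbond : forall l r, fine (mu (vbond l r) [set true]) = delta.
Hypothesis mu_hbond : forall l r n, (n < L)%N ->
  fine (mu (hbond l r n) [set true]) = p n.+1.

Lemma pr_open_vbond l r : pr P (open_vbond l r) = delta.
Proof. by rewrite /open_vbond (pr_coordinate PP) mu_vbond. Qed.

Lemma pr_leg N M l r (c : R) : 0 < c -> (0 < N)%N -> (N + M <= L)%N ->
  c <= \sum_(n <- iota 0 M) p n.+1 * p (N + n).+1 ->
  c / (1 + c) <= pr P (leg N M l r).
Proof.
move=> c0 N0 NML hc.
pose both n : set (bond -> bool) :=
  [set w | w (hbond l r (N + n))] `&` [set w | w (hbond (l + N) r n)].
pose S n : set bond := [set hbond l r (N + n)] `|` [set hbond (l + N) r n].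
have both_local n : local (S n) (both n) by apply: localI; exact: local_coordinate.
have fail_local : local (leg_support N M l r)
    [set w | forall n, n \in iota 0 M -> (~` both n) w].
  by have := localC (leg_local N M l r); rewrite setCK.
rewrite /leg (prC P fail_local) (pr_all PP (Q := S)) ?iota_uniq//.
- rewrite big_seq (eq_bigr (fun n => 1 - p n.+1 * p (N + n).+1)); last first.
    move=> n; rewrite mem_iota => /= nM; rewrite (prC P (both_local n)).
    rewrite (prI PP _ (local_coordinate _) (local_coordinate _)).
      by rewrite !(pr_coordinate PP) !mu_hbond; [rewrite mulrC|lia|lia].
    by apply/seteqP; split => // b [/= -> /hbond_inj[]]; lia.
  rewrite -big_seq.
  have x01 n : n \in iota 0 M -> 0 <= p n.+1 * p (N + n).+1 <= 1.
    move=> _; have /andP[a0 a1] := p01 n; have /andP[b0 b1] := p01 (N + n)%N.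
    by rewrite mulr_ge0//= mulr_ile1.
  have := prod_one_minus_le x01; move: hc.
  have : 0 <= \prod_(n <- iota 0 M) (1 - p n.+1 * p (N + n).+1).
    by rewrite big_seq prodr_ge0// => n /x01 /andP[_]; rewrite subr_ge0.
  move: (\sum_(_ <- _) _) (\prod_(_ <- _) _) => s q q0 cs qs.
  rewrite ler_pdivrMr ?addr_gt0//.
  have : q * (1 + c) <= 1 by apply: le_trans qs; apply: ler_wpM2l => //; lra.
  lra.
- move=> n n'; rewrite !mem_iota => _ _ x.
  by move=> [/= ->|/= ->] [/= /hbond_inj[]|/= /hbond_inj[]]; lia.
- by move=> n _; apply: localC.
Qed.

Variables (N M : nat -> nat) (m : nat) (c : R).
Hypothesis NS : forall i, (N i + M i < N i.+1)%N.
Hypothesis N0 : (0 < N 0)%N.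
Hypothesis c0 : 0 < c.
Hypothesis NM_sum : forall i, c <= \sum_(n <- iota 0 (M i)) p n.+1 * p (N i + n).+1.
Hypothesis reachL : (max_length N M m <= L)%N.

Local Notation D := (N (4 * m)).
Local Notation leg_bound := (c / (1 + c)).

Let leg_bound01 : 0 < leg_bound <= 1.
Proof. by rewrite divr_gt0 ?addr_gt0//= ler_pdivrMr ?addr_gt0//; lra. Qed.

Let pr_spur i l r : (i <= 4 * m)%N -> leg_bound <= pr P (spur N M i l r).
Proof.
move=> im; apply: pr_leg => //; first exact: sparse_gt0.
apply: leq_trans reachL; rewrite /max_length; move: im; rewrite leq_eqVlt => /orP[/eqP ->//|im].
by have := sparse NS im; lia.
Qed.

(** Three legs and two vertical bonds, the cost of a horizontal detour; a vertical one is
    cheaper. *)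
Definition detour_bound : R := leg_bound ^+ 3 * delta ^+ 2.

Lemma detour_bound01 : 0 < detour_bound <= 1.
Proof.
have /andP[d0 d1] := delta01; have /andP[b0 b1] := leg_bound01.
rewrite /detour_bound mulr_gt0 ?exprn_gt0//=.
by apply: mulr_ile1; rewrite ?exprn_ge0 ?exprn_ile1// ltW.
Qed.

Let leg_disjoint N1 M1 l1 r1 N2 M2 l2 r2 :
  r1 <> r2 \/ [/\ l1 <> l2, l1 <> (l2 + N2)%N, (l1 + N1)%N <> l2 & (l1 + N1)%N <> (l2 + N2)%N] ->
  forall b, leg_support N1 M1 l1 r1 b -> leg_support N2 M2 l2 r2 b -> False.
Proof.
by move=> [?|[? ? ? ?]] b [n _ [->|->]] [n' _ [/hbond_inj[]|/hbond_inj[]]]; lia.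
Qed.

Let leg_vbond N1 M1 l1 r1 l2 r2 :
  forall b, leg_support N1 M1 l1 r1 b -> [set vbond l2 r2] b -> False.
Proof. by move=> b [n _ [->|->]]. Qed.

Let vbond_vbond l1 r1 l2 r2 : l1 <> l2 \/ r1 <> r2 ->
  forall b, [set vbond l1 r1] b -> [set vbond l2 r2] b -> False.
Proof. by move=> h b -> /vbond_inj[]; lia. Qed.

Lemma pr_detour (s : cell) right j : (j < m)%N ->
  detour_bound <= pr P (detour N M m s right j).
Proof.
move=> jm; have im := class_index_lt s right jm.
have /andP[d0 d1] := delta01; have /andP[b0 b1] := leg_bound01.
pose lb := leg_bound.
have ps k l r : (k <= 4 * m)%N -> lb <= pr P (spur N M k l r) by exact: pr_spur.
have boundE : detour_bound = lb ^+ 3 * delta ^+ 2 by [].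
have {}b1 : lb <= 1 by []; have {b0}b0' : 0 <= lb by exact: ltW.
have d0' := ltW d0; move: lb ps boundE b0' b1 => lb ps boundE b0' b1.
rewrite /detour; set i := class_index s right j in im *.
have iD := sparse NS im; have i0 := sparse_gt0 NS N0 i.
have spur_local k l r : local (spur_support N M k l r) (spur N M k l r).
  exact: leg_local.
have V := open_vbond_local.
set x := xpos _ _ _; set y := ypos _.
case: right @i im iD i0 => i im iD i0.
  have l5 := spur_local i (x + D)%N y.
  have l4 := localI (V (x + N i + D)%N y) l5.
  have l3 := localI (spur_local (4 * m)%N (x + N i)%N y.+1) l4.
  have l2 := localI (V (x + N i)%N y) l3.
  rewrite (prI PP _ (spur_local _ _ _) l2); last first.
    apply/seteqP; split => // b [h []]; first by move/(leg_vbond h).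
    move=> []; first by apply: leg_disjoint h; left; lia.
    move=> []; first by move/(leg_vbond h).
    by apply: leg_disjoint h; right; split; lia.
  rewrite (prI PP _ (V _ _) l3); last first.
    apply/seteqP; split => // b [h []]; first by move=> h'; exact: (leg_vbond h' h).
    move=> []; first by apply: vbond_vbond h; lia.
    by move=> h'; exact: (leg_vbond h' h).
  rewrite (prI PP _ (spur_local _ _ _) l4); last first.
    apply/seteqP; split => // b [h []]; first by move/(leg_vbond h).
    by apply: leg_disjoint h; left; lia.
  rewrite (prI PP _ (V _ _) l5); last first.
    by apply/seteqP; split => // b [h h']; exact: (leg_vbond h' h).
  rewrite !pr_open_vbond.
  have -> : detour_bound = lb * (delta * (lb * (delta * lb))).
    by rewrite boundE; ring.
  apply: ler_pM; rewrite ?mulr_ge0 ?ps ?(ltnW im)//.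
  apply: ler_pM; rewrite ?mulr_ge0//.
  apply: ler_pM; rewrite ?mulr_ge0 ?ps//.
  by apply: ler_pM; rewrite ?ps ?(ltnW im).
have l4 := spur_local i x y.+2.
have l3 := localI (V (x + N i)%N y.+1) l4.
have l2 := localI (V (x + N i)%N y) l3.
rewrite (prI PP _ (spur_local _ _ _) l2); last first.
  apply/seteqP; split => // b [h []]; first by move/(leg_vbond h).
  move=> []; first by move/(leg_vbond h).
  by apply: leg_disjoint h; left; lia.
rewrite (prI PP _ (V _ _) l3); last first.
  apply/seteqP; split => // b [h []]; first by apply: vbond_vbond h; lia.
  by move=> h'; exact: (leg_vbond h' h).
rewrite (prI PP _ (V _ _) l4); last first.
  by apply/seteqP; split => // b [h h']; exact: (leg_vbond h' h).
rewrite !pr_open_vbond.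
apply: (@le_trans _ _ (lb * (delta * (delta * lb)))).
  have -> : detour_bound = lb * (delta * (delta * lb)) * lb.
    by rewrite boundE; ring.
  by rewrite ler_piMr// !mulr_ge0.
apply: ler_pM; rewrite ?mulr_ge0 ?ps ?(ltnW im)//.
apply: ler_pM; rewrite ?mulr_ge0//.
by apply: ler_pM; rewrite ?ps ?(ltnW im).
Qed.

Definition no_detour (s : cell) (right : bool) : set (bond -> bool) :=
  [set w | forall j, j \in iota 0 m -> ~ detour N M m s right j w].

Definition bad_site (s : cell) : set (bond -> bool) :=
  no_detour s true `|` no_detour s false.

Definition site_support (s : cell) : set bond :=
  [set b | exists right j, (j < m)%N /\ detour_support N M m s right j b].

Lemma no_detour_local s right : local (site_support s) (no_detour s right).
Proof.
apply: local_all => j; rewrite mem_iota => /= jm; apply: localC.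
by apply: localS (detour_local N M m s right j) => b hb; exists right, j.
Qed.

Lemma bad_site_local s : local (site_support s) (bad_site s).
Proof. by apply: localU; exact: no_detour_local. Qed.

Lemma site_support_disjoint s t b : site_support s b -> site_support t b -> s = t.
Proof.
move=> [right [j [jm h]]] [right' [j' [jm' h']]].
by have [] := detour_support_disjoint NS N0 jm jm' h h'.
Qed.

Lemma pr_bad_site s : pr P (bad_site s) <= 2 * (1 + m%:R * detour_bound)^-1.
Proof.
have /andP[q0 q1] := detour_bound01.
have fail right : pr P (no_detour s right) <= (1 + m%:R * detour_bound)^-1.
  have lC j : local (detour_support N M m s right j) (~` detour N M m s right j).
    by apply: localC; exact: detour_local.
  rewrite /no_detour (@pr_all _ _ _ _ PP _ (iota 0 m)
    (detour_support N M m s right) (fun j => ~` detour N M m s right j)) ?iota_uniq//; last first.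
    move=> j j'; rewrite !mem_iota => /= jm jm' b h h'.
    by have [] := detour_support_disjoint NS N0 jm jm' h h'.
  apply: (@le_trans _ _ (\prod_(j <- iota 0 m) (1 - detour_bound))).
    rewrite big_seq [leRHS]big_seq; apply: ler_prod => j; rewrite mem_iota => /= jm.
    by rewrite pr_ge0 (prC P (detour_local _ _ _ _ _ _)) lerD2l lerN2 pr_detour.
  have := @prod_one_minus_le R _ (iota 0 m) (fun=> detour_bound) _.
  rewrite [\sum_(_ <- _) _]big_const_seq count_predT size_iota iter_addr_0 mulr_natl => h.
  rewrite -[leRHS]mul1r ler_pdivlMr; first by apply: h => j _; rewrite ltW.
  by rewrite ltr_pwDl// mulrn_wge0// ltW.
apply: le_trans (prU P (no_detour_local s true) (no_detour_local s false)) _.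
by rewrite mulr2n mulrDl mul1r lerD.
Qed.

End detour_probability.

(** * From the upper limit to percolation *)

Lemma limn_esup_gt (R : realType) (u : nat -> \bar R) (c : \bar R) :
  (c < limn_esup u)%E -> forall b, exists2 N, (b < N)%N & (c < u N)%E.
Proof.
move=> cu b; apply: contrapT => h; move: cu; apply/negP; rewrite -leNgt.
apply: (@le_trans _ _ (ereal_sup (u @` [set N | (b < N)%N]))).
  apply: ereal_inf_lbound; exists [set N | (b < N)%N] => //.
  by exists b.+1.
apply: ge_ereal_sup => _ [N /= bN <-]; rewrite leNgt; apply/negP => cN.
by apply: h; exists N.
Qed.

Lemma nneseries_gt (R : realType) (x : nat -> R) (c : R) :
  (forall n, 0 <= x n.+1) -> (c%:E < \sum_(1 <= n <oo) (x n)%:E)%E ->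
  exists M, c <= \sum_(n <- iota 0 M) x n.+1.
Proof.
move=> x0 cx; apply: contrapT => /forallNP h; move: cx; apply/negP; rewrite -leNgt.
apply: lime_le; first by apply: is_cvg_nneseries => -[//|n] _ _; rewrite lee_fin.
apply: nearW => n /=; rewrite sumEFin lee_fin big_add1 /index_iota subn0.
by apply: ltW; rewrite ltNge; apply/negP; exact: h.
Qed.

(** The hypothesis on the upper limit gives arbitrarily large shifts [N] whose sum, cut at some
    [M], is at least [c]; each shift is chosen beyond the previous [N + M]. *)
Lemma sparse_sequence (R : realType) (p : nat -> R) :
  (forall n, 0 <= p n.+1 <= 1) ->
  (0 < limn_esup (fun N : nat => \sum_(1 <= n <oo) (p n * p (n + N)%N)%:E))%E ->
  exists c N M, [/\ 0 < c, (0 < N 0)%N, forall i : nat, (N i + M i < N i.+1)%N &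
    forall i : nat, c <= \sum_(n <- iota 0 (M i)) p n.+1 * p (N i + n).+1].
Proof.
move=> p01 hl.
have [c c0 cl] : exists2 c : R, 0 < c & (c%:E < limn_esup (fun N : nat =>
    \sum_(1 <= n <oo) (p n * p (n + N)%N)%:E))%E.
  case: (limn_esup _) hl => [r| |//] h; last by exists 1; rewrite ?ltry.
  by exists (r / 2); rewrite ?lte_fin in h *; lra.
have /choice[f hf] b : exists NM : nat * nat, (b < NM.1)%N /\
    c <= \sum_(n <- iota 0 NM.2) p n.+1 * p (NM.1 + n).+1.
  have [N bN cN] := limn_esup_gt cl b.
  have [|M hM] := @nneseries_gt _ (fun n => p n * p (n + N)%N) c _ cN.
    by move=> n; have /andP[? _] := p01 n; have /andP[? _] := p01 (n + N)%N; rewrite mulr_ge0.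
  exists (N, M); split => //=; apply: le_trans hM _.
  by apply: ler_sum => n _; rewrite addSn addnC.
pose s k := iter k (fun x => f (x.1 + x.2)%N) (f 0%N).
exists c, (fun k => (s k).1), (fun k => (s k).2); split => //.
- exact: (hf 0%N).1.
- by move=> i; exact: (hf _).1.
- by case=> [|i]; exact: (hf _).2.
Qed.

Lemma fine_bernoulli (R : realType) (q : R) :
  0 <= q <= 1 -> fine (bernoulli_prob q [set true]) = q.
Proof. by move=> q01; rewrite /bernoulli_prob q01 fsbig_set1. Qed.

Lemma good_site_joined (N M : nat -> nat) (m : nat) (s : cell) (right : bool) w :
  (forall i, (N i + M i < N i.+1)%N) -> ~ bad_site N M m s w ->
  joined (restrict (max_length N M m) w) (site N m s)
    (site N m (if right then (s.1.+1, s.2) else (s.1, s.2.+1))).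
Proof.
move=> NS good; apply: contrapT => nc.
have : no_detour N M m s right w.
  move=> j; rewrite mem_iota => /= jm h; apply: nc; exact: (detour_joined NS jm h).
by move=> h; apply: good; case: right h {nc}; [left|right].
Qed.

Lemma good_boxes_percolate (N M : nat -> nat) (m : nat) w :
  (forall i, (N i + M i < N i.+1)%N) -> (0 < N 0)%N ->
  (forall k, ~ bad_box (fun s => bad_site N M m s w) k (0, 0)%N) ->
  origin_to_infinity w.
Proof.
move=> NS N0 good; apply: (@infinite_cluster (max_length N M m)) => k.
have [||||c kc conn] := @good_boxes_connect (fun s => bad_site N M m s w)
  (fun s t => joined (restrict (max_length N M m) w) (site N m s) (site N m t)) _ _ _ _ good k.
- by move=> c; exact: joined_refl.
- by move=> c d; exact: joined_sym.
- by move=> d c c'; exact: joined_trans.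
- move=> c d /orP[]/eqP -> gc _.
    exact: (good_site_joined true NS gc).
  exact: (good_site_joined false NS gc).
exists (xpos N m c), (ypos c); split => //.
have := sparse_gt0 NS N0 (4 * m); have := ltn_expl k (isT : 1 < 3)%N.
rewrite /xpos /ypos; nia.
Qed.

Theorem theorem2 (R : realType) (delta : R) (p : nat -> R)
    (hdelta : 0 < delta <= 1)
    (hp : forall n : nat, (1 <= n)%N -> 0 <= p n <= 1)
    (hlimsup : (0 < limn_esup (fun N : nat =>
       \sum_(1 <= n <oo) (p n * p (n + N)%N)%:E))%E) :
  percolation_measure delta (truncate p K) origin_to_infinity
    @[K --> \oo] --> (1%E : \bar R).
Proof.
have p01 n : 0 <= p n.+1 <= 1 by exact: hp.
have [c [N [M [c0 N0 NS NM_sum]]]] := sparse_sequence p01 hlimsup.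
pose mass K := percolation_measure delta (truncate p K) origin_to_infinity.
have mass1 K : (mass K <= 1)%E.
  rewrite -(probability_setT (product_measure (bond_law delta (truncate p K)))).
  rewrite -(percolation_measureE delta (truncate p K) measurableT).
  exact: le_mu_ext.
have mass0 K : (0 <= mass K)%E by exact: mu_ext_ge0.
have massE K : mass K \is a fin_num.
  by rewrite ge0_fin_numE//; apply: le_lt_trans (mass1 K) _; rewrite ltry.
apply/fine_cvgP; split; first by apply: nearW => K; exact: massE.
apply/cvgrPdist_le => e e0.
have [q qE q0] : exists2 q, q = detour_bound delta c & 0 < q.
  by exists (detour_bound delta c) => //; have /andP[] := detour_bound01 hdelta c0.
have [t t0 [t2 te]] : exists2 t : R, 0 < t & t <= 2^-1 /\ t <= e / 2.
  exists (Num.min (2^-1) (e / 2)); first by rewrite lt_min invr_gt0 ltr0n divr_gt0.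
  by rewrite !ge_min !lexx orbT.
(* 144 = 72 * 2: the grid pairs, times the two directions in which a site can fail. *)
have [m hm] : exists m : nat, 144%:R <= t * (1 + m%:R * q).
  have tq0 : 0 < t * q by rewrite mulr_gt0.
  have h0 : 0 <= 144%:R / (t * q) by rewrite divr_ge0 ?ler0n// ltW.
  exists (Num.bound (144%:R / (t * q))); have := archi_boundP h0.
  rewrite ltr_pdivrMr//; move: (_%:R) => x; have := t0; lra.
exists (max_length N M m) => //= K LK.
pose mu := bond_law delta (truncate p K).
have PP := product_measureP mu.
have mu_v l r : fine (mu (vbond l r) [set true]) = delta.
  by rewrite fine_bernoulli//; lra.
have mu_h l r n : (n < max_length N M m)%N -> fine (mu (hbond l r n) [set true]) = p n.+1.
  move=> nL; rewrite /= /truncate (leq_trans nL LK) fine_bernoulli//.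
set P := product_measure mu in PP.
have badP s : pr P (bad_site N M m s) <= 2 * (1 + m%:R * q)^-1.
  rewrite qE; exact: (pr_bad_site PP hdelta p01 mu_v mu_h NS N0 c0 NM_sum (leqnn _)).
have tq : 72%:R * (2 * (1 + m%:R * q)^-1) <= t.
  by rewrite mulrA -natrM ler_pdivrMr ?ltr_pwDl// mulr_ge0// ltW.
have [|Pgood mgood] := @pr_no_bad_box _ _ _ _ PP (site_support N M m) (bad_site N M m) _
  (site_support_disjoint NS N0) (bad_site_local N M m) badP _.
  exact: le_trans tq t2.
(* The event itself is measurable only for the completed measure, but the outer measure is
   monotone and agrees with [P] on the measurable event of good boxes. *)
have : (P [set w | forall k, ~ bad_box (fun s => bad_site N M m s w) k (0, 0)%N] <= mass K)%E.
  rewrite -(percolation_measureE delta (truncate p K) mgood).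
  apply: le_mu_ext => w; exact: good_boxes_percolate.
move=> /(le_trans Pgood); rewrite -[mass K]fineK// lee_fin => low.
have := mass1 K; rewrite -[mass K]fineK// lee_fin => up.
by rewrite /= -/(mass K) ler_norml; lra.
Qed.
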